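(* Let $n\ge 1$ and let $\lambda^{(1)}/\mu^{(1)},\ldots,\lambda^{(k)}/\mu^{(k)}$ be skew shapes, each of which does not contain a $3\times 2$ block of cells, with $\ell(\lambda^{(i)})\le n$ for all $i$. Then for every $\tau\in\mathcal B_n$, the multi-symmetric function \[\mathrm{Imm}_{\tau}\left(\mathrm{JT}^n_{\lambda^{(1)}/\mu^{(1)}}(\mathbf x^{(1)})*\cdots*\mathrm{JT}^n_{\lambda^{(k)}/\mu^{(k)}}(\mathbf x^{(k)})\right)\] is Schur positive.
   Context: For variables $\mathbf x=(x_1,x_2,\dots)$, $e_d(\mathbf x)$ denotes the elementary symmetric function, with $e_0=1$ and $e_d=0$ for $d<0$. Partitions $\lambda$ have $\lambda_i=0$ for $i>\ell(\lambda)$ ($\ell(\lambda)$ = number of nonzero parts). For partitions $\mu\subseteq\lambda$ (i.e. $\mu_i\le\lambda_i$ for all $i$), the skew shape $\lambda/\mu$ is the set of cells $(i,j)$ with $\mu_i<j\le\lambda_i$ (row $i$, column $j$, rows numbered top to bottom). $\lambda/\mu$ contains a $3\times 2$ block of cells if there are $i,j$ with $(i,j),(i,j+1),(i+1,j),(i+1,j+1),(i+2,j),(i+2,j+1)$ all in $\lambda/\mu$; equivalently $\lambda_{i+2}\ge\mu_i+2$ for some $i$. For $n\ge\ell(\lambda)$, $\mathrm{JT}^n_{\lambda/\mu}(\mathbf x)=(e_{\lambda_i-\mu_j-i+j}(\mathbf x))_{i,j=1}^n$ (so $\det\mathrm{JT}^n_{\lambda/\mu}(\mathbf x)=s_{\lambda'/\mu'}(\mathbf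 x)$). For $n\times n$ matrices $A^{(p)}$ with entries in $\Lambda(\mathbf x^{(p)})$ (symmetric functions in the variable set $\mathbf x^{(p)}$, the variable sets being distinct), the Hadamard product $A^{(1)}*\cdots*A^{(k)}$ is the entrywise product, with entries in $\Lambda(\mathbf x^{(1)})\otimes\cdots\otimes\Lambda(\mathbf x^{(k)})$. Such a multi-symmetric function is Schur positive if its expansion in the basis $s_{\nu_1}(\mathbf x^{(1)})\cdots s_{\nu_k}(\mathbf x^{(k)})$ has nonnegative coefficients (monomial positive: same with monomial symmetric functions $m_\nu$). Immanants: for $f:\mathfrak S_n\to\mathbb C$, extended linearly to $\mathbb C[\mathfrak S_n]$, $\mathrm{Imm}_f(M)=\sum_{w\in\mathfrak S_n}f(w)M_{1,w(1)}\cdots M_{n,w(n)}$. $\mathrm{TL}_n(2)$ is the associative $\mathbb C$-algebra generated by $t_1,\dots,t_{n-1}$ with relations $t_i^2=2t_i$, $t_it_jt_i=t_i$ if $|i-j|=1$, $t_it_j=t_jt_i$ if $|i-j|\ge 2$. It has the standard basis $\mathcal B_n$ of Kauffman diagrams (noncrossing perfect matchings on $2n$ points arranged in two columns of $n$; multiplication is concatenation, each closed loop removed giving a factor $2$; $t_i$ is the diagram joining the $i$th and $(i+1)$st points on each side, all other points joined horizontally; $1$ is the all-horizontal diagram). Let $s_i=(i,i+1)\in\mathfrak S_n$ (permutations composed left to right) and let $\theta:\mathbb C[\mathfrak S_n]\to\mathrm{TL}_n(2)$ be the algebra homomorphism with $\theta(s_i)=t_i-1$. For $\tau\in\mathcal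 B_n$, $f_\tau(w)$ is the coefficient of $\tau$ in $\theta(w)$ in the basis $\mathcal B_n$, and $\mathrm{Imm}_\tau:=\mathrm{Imm}_{f_\tau}$ (the Temperley–Lieb immanant). For $\tau=1$, $\mathrm{Imm}_\tau=\det$. *)

(* Defs.v *)
From HB Require Import structures.
From mathcomp Require Import all_boot all_order all_algebra all_fingroup.
From mathcomp Require Import mpoly.
Set Implicit Arguments.
Unset Strict Implicit.
Unset Printing Implicit Defensive.
Import Order.TTheory GRing.Theory Num.Theory.
Local Open Scope ring_scope.

(* Partitions and skew shapes (rows 0-based; lambda_i = nth 0 lambda i) *)
Definition is_partition (s : seq nat) : bool :=
  sorted geq s && all (fun x => (0 < x)%N) s.

Definition subpart (mu lam : seq nat) : Prop :=
  forall i, (nth 0 mu i <= nth 0 lam i)%N.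

(* cell (i,j) (row i 0-based, column j 1-based) lies in lam/mu *)
Definition in_skew (lam mu : seq nat) (i j : nat) : bool :=
  (nth 0 mu i < j <= nth 0 lam i)%N.

Definition has_block32 (lam mu : seq nat) : Prop :=
  exists i j, [&& in_skew lam mu i j, in_skew lam mu i j.+1,
                  in_skew lam mu i.+1 j, in_skew lam mu i.+1 j.+1,
                  in_skew lam mu i.+2 j & in_skew lam mu i.+2 j.+1].

Definition conjp (nu : seq nat) : seq nat :=
  mkseq (fun j => count (fun x => j < x)%N nu) (head 0%N nu).

(* Multi-symmetric functions.  Lambda = Z[e_1,e_2,...] freely; the part
   of Lambda(x^(1)) ⊗ ... ⊗ Lambda(x^(k)) generated by e_d(x^(p)),
   d <= D, is the polynomial ring in the k*D variables
   'X_(mxvec_index p (d-1)) standing for e_d(x^(p)). *)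
Definition msym_ring (k D : nat) := {mpoly int[k * D]}.

(* e_d(x^(p)) for d : nat (e_0 = 1; e_d for d > D is outside the model
   and set to 0, never used in the statement for d > D) *)
Definition evar (k D : nat) (p : 'I_k) (d : nat) : msym_ring k D :=
  match d with
  | 0%N => 1
  | d'.+1 => oapp (fun o : 'I_D => 'X_(mxvec_index p o)) 0 (insub d')
  end.

Definition eZ (k D : nat) (p : 'I_k) (z : int) : msym_ring k D :=
  match z with Posz d => evar D p d | Negz _ => 0 end.

(* Schur function s_nu(x^(p)) via the dual Jacobi-Trudi identity
   s_nu = det (e_{nu'_i - i + j})_{i,j <= l(nu')} *)
Definition schur (k D : nat) (p : 'I_k) (nu : seq nat) : msym_ring k D :=
  let c := conjp nu in
  \det (\matrix_(i < size c, j < size c)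
          eZ D p ((nth 0%N c i + j)%:Z - (i : nat)%:Z)).

(* Schur positivity: F is a nonnegative integer combination of products
   s_{nu_1}(x^(1)) ... s_{nu_k}(x^(k)).  Since F lies in the degree <= D
   part, only |nu_p| <= D can occur in its Schur expansion. *)
Definition schur_positive (k D : nat) (F : msym_ring k D) : Prop :=
  exists (m : nat) (nu : 'I_m -> 'I_k -> seq nat) (c : 'I_m -> nat),
    (forall t p, is_partition (nu t p) /\ (sumn (nu t p) <= D)%N) /\
    F = \sum_(t < m) (c t)%:R * \prod_(p < k) schur D p (nu t p).

Definition JT_hadamard (k D n : nat) (lam mu : 'I_k -> seq nat)
  : 'M[msym_ring k D]_n :=
  \matrix_(i < n, j < n)
     \prod_(p < k) eZ D p ((nth 0%N (lam p) i + j)%:Z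
                           - (nth 0%N (mu p) j + i)%:Z).

(* Temperley-Lieb algebra TL_n(2) with its Kauffman diagram basis.
   Boundary points: (false, r) = r-th point of the left column,
   (true, r) = r-th point of the right column (rows 0-based, top to
   bottom).  A diagram is encoded by its partner function. *)
Definition pt (n : nat) := (bool * 'I_n)%type.
Definition diag (n : nat) := {ffun pt n -> pt n}.

(* position on the boundary circle: left column top to bottom, then
   right column bottom to top *)
Definition cpos (n : nat) (p : pt n) : nat :=
  if p.1 then ((n + n).-1 - p.2)%N else p.2.

Definition is_kauffman (n : nat) (d : diag n) : Prop :=
  [/\ forall p, d (d p) = p,
      forall p, d p != p &
      forall p q, ~~ [&& (cpos p < cpos q)%N, (cpos q < cpos (d p))%N
                       & (cpos (d p) < cpos (d q))%N]].

(* concatenation g . h : right column of g glued to left column of h.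
   walk fuel true r  : entering g at its right point r;
   walk fuel false r : entering h at its left point r. *)
Fixpoint walk (n : nat) (g h : diag n) (fuel : nat) (ing : bool) (r : 'I_n)
  : pt n :=
  match fuel with
  | 0%N => (ing, r)
  | f.+1 =>
    if ing then
      let q := g (true, r) in
      if ~~ q.1 then (false, q.2) else walk g h f false q.2
    else
      let q := h (false, r) in
      if q.1 then (true, q.2) else walk g h f true q.2
  end.

Definition concat (n : nat) (g h : diag n) : diag n :=
  [ffun p : pt n =>
     if ~~ p.1 then
       let q := g (false, p.2) in
       if ~~ q.1 then (false, q.2) else walk g h (n + n) false q.2
     else
       let q := h (true, p.2) in
       if q.1 then (true, q.2) else walk g h (n + n) true q.2].

(* closed loops formed in the middle column when concatenating g and h *)
Definition mid_rel (n : nat) (g h : diag n) : rel 'I_n :=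
  fun r r' => (g (true, r) == (true, r')) || (h (false, r) == (false, r')).

Definition nloops (n : nat) (g h : diag n) : nat :=
  #|[set r : 'I_n |
      [forall r' : 'I_n, connect (mid_rel g h) r r' ==>
         [&& (g (true, r')).1, ~~ (h (false, r')).1 & (r <= r')%N]]]|.

(* elements of TL_n(2): integer combinations of diagrams (only the
   coefficients on Kauffman diagrams are ever nonzero) *)
Definition tl (n : nat) := {ffun diag n -> int}.

Definition tl_basis (n : nat) (d : diag n) : tl n :=
  [ffun f => (f == d)%:R].

Definition tl_mul (n : nat) (a b : tl n) : tl n :=
  [ffun f => \sum_(g : diag n) \sum_(h : diag n)
               a g * b h * 2 ^+ nloops g h * (concat g h == f)%:R].

Definition id_diag (n : nat) : diag n := [ffun p : pt n => (~~ p.1, p.2)].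
Definition tl_one (n : nat) : tl n := tl_basis (id_diag n).

Definition t_diag (n : nat) (i j : 'I_n) : diag n :=
  [ffun p : pt n => if p.2 == i then (p.1, j)
                    else if p.2 == j then (p.1, i) else (~~ p.1, p.2)].

(* theta : C[S_n] -> TL_n(2), algebra hom with theta(s_i) = t_i - 1
   (permutations compose left to right, as in MathComp's {perm}) *)
Definition is_theta (n : nat) (theta : {perm 'I_n} -> tl n) : Prop :=
  [/\ theta 1%g = tl_one n,
      forall u v : {perm 'I_n}, theta (u * v)%g = tl_mul (theta u) (theta v) &
      forall i j : 'I_n, val j = (val i).+1 ->
        theta (tperm i j) = tl_basis (t_diag i j) - tl_one n].

Definition immanant (R : comRingType) (n : nat) (f : {perm 'I_n} -> int)
  (M : 'M[R]_n) : R :=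
  \sum_(w : {perm 'I_n}) (\prod_(i < n) M i (w i)) *~ f w.

(* Main.v *)
(* Having no 3x2 block means that the Jacobi-Trudi matrices, hence their Hadamard product, vanish
   below the subdiagonal.  Only the permutations [w_S], the increasing product of the s_i with
   i in S, S a subset of {1..n-1}, contribute to the immanant.

   For a single skew shape let [al i = lam_i - i], [be j = mu_j - j].  By Pieri, the product of the
   [e_(al i - be (w i))] is the sum of Schur functions over chains of partitions whose i-th step is a
   strip of size [al i - be (w i)].  Call a chain with the sizes of [w = 1] bad at i if the bracket
   matching between its strips i and i+1 has at most [al (i+1) - be i] pairs.  Crystal operators
   transport the chains with the sizes of [w_S] to the chains with the sizes of [w = 1] that are bad
   at all of S; the processing of one element of S does not disturb the badness at the others, again
   because there is no 3x2 block.  So the product is the sum over all chains X with [S \subset U(X)],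
   where [U(X)] is the set of bad places.

   Multiplying over the k shapes and exchanging sums, the immanant is the sum over k-tuples of chains
   of a product of Schur functions times the sum of [f_tau(w_S)] over the subsets S of the
   intersection T of the [U(X_p)].  The latter is the coefficient of tau in the product of the
   [1 + (t_i - 1) = t_i], i in T, which is nonnegative. *)
Require Import Defs.
From HB Require Import structures.
From mathcomp Require Import all_boot all_order all_algebra all_fingroup.
From mathcomp Require Import mpoly.
From mathcomp Require Import zify.
Set Implicit Arguments.
Unset Strict Implicit.
Unset Printing Implicit Defensive.
Import Order.TTheory GRing.Theory Num.Theory.
Local Open Scope ring_scope.

(** * Jacobi-Trudi determinants and the Pieri rule *)

Lemma det_last_row (R : comNzRingType) (m : nat) (A : 'M[R]_m.+1) :
  (forall j, j != ord_max -> A ord_max j = 0) ->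
  \det A = A ord_max ord_max * \det (row' ord_max (col' ord_max A)).
Proof.
move=> A0; rewrite (expand_det_row _ ord_max) (bigD1 ord_max) //= big1 ?addr0.
  by rewrite /cofactor -signr_odd oddD addbb mul1r.
by move=> j /A0 ->; rewrite mul0r.
Qed.

Lemma det_sum_rows (R : comNzRingType) (I : finType) (m : nat)
    (P : 'I_m -> pred I) (F : 'I_m -> I -> 'I_m -> R) :
  \det (\matrix_(i, j) \sum_(x | P i x) F i x j) =
  \sum_(f in family P) \det (\matrix_(i, j) F i (f i) j).
Proof.
rewrite [RHS]exchange_big /=; apply: eq_bigr => s _.
rewrite -mulr_sumr; congr (_ * _).
under eq_bigr do rewrite mxE.
rewrite (bigA_distr_big_dep P) /=.
by apply: eq_bigr => f _; apply: eq_bigr => i _; rewrite mxE.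
Qed.

(* The identities below hold for an arbitrary sequence [h]; in particular they are insensitive to
   the truncation [e_d = 0] for [d > D]. *)
Section JacobiTrudi.
Variables (R : comNzRingType) (h : int -> R).
Hypothesis h0 : h 0 = 1.
Hypothesis hN : forall z : int, z < 0 -> h z = 0.

Definition jt (m : nat) (f : nat -> nat) : R :=
  \det (\matrix_(i < m, j < m) h ((f i + j)%:Z - (i : nat)%:Z)).

Lemma jtS0 (m : nat) (f : nat -> nat) : f m = 0%N -> jt m.+1 f = jt m f.
Proof.
move=> fm; rewrite /jt det_last_row.
  rewrite mxE /= fm add0n subrr h0 mul1r; congr (\det _).
  by apply/matrixP => i j; rewrite !mxE !lift_max.
move=> j jm; rewrite mxE /= fm hN //.
by have := ltn_ord j; move: jm; rewrite -val_eqE /=; lia.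
Qed.

(** [schur] takes a determinant whose size is the number of columns of its index, [sjt] one of the
    fixed size [N.+1]; this reconciles the two. *)
Lemma jt_trunc (l m : nat) (f : nat -> nat) : (l <= m)%N ->
  (forall i, (l <= i)%N -> f i = 0%N) -> jt m f = jt l f.
Proof.
move=> lm f0; rewrite -(subnK lm); elim: (m - l)%N => //= d IHd.
by rewrite addSn jtS0 ?IHd // f0 // leq_addl.
Qed.

Lemma eq_jt (m : nat) (f g : nat -> nat) :
  (forall i, (i < m)%N -> f i = g i) -> jt m f = jt m g.
Proof.
by move=> fg; congr (\det _); apply/matrixP => i j; rewrite !mxE fg.
Qed.

End JacobiTrudi.

(* Row lengths; that they decrease is not part of the type but follows from [hstrip b b].
   The [e_d] play here the role of complete functions: the rows are the columns of the partition
   indexing the Schur function. *)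
Definition bpart (N D : nat) := {ffun 'I_N.+1 -> 'I_D.+1}.

Section Strips.
Variables N D : nat.
Implicit Types (a b c : bpart N D) (i j k : 'I_N.+1).

Definition weight a : int := \sum_k (a k : nat)%:Z.

(** Interlacing: [b/a] is a horizontal strip for the row lengths, hence a vertical strip for the
    indexing partitions. The top row of [b] is bounded above by [D] only, through its type. *)
Definition hstrip a b : bool :=
  [forall k, (a k <= b k)%N && ((0 < k)%N ==> (b k <= a (inord k.-1))%N)].

Lemma hstripP a b : reflect
  ((forall k, (a k <= b k)%N) /\
   forall k k', k' = k.+1 :> nat -> (b k' <= a k)%N) (hstrip a b).
Proof.
apply: (iffP forallP) => [ab | [ab ba] k].
  split=> [k|k k' k'E]; first by have /andP[] := ab k.
  have /andP[_] := ab k'; rewrite k'E /= => le.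
  suff <-: inord k = k by [].
  by rewrite inord_val.
rewrite ab; apply/implyP => k0; apply: ba.
by rewrite inordK prednK // ltnW.
Qed.

End Strips.

Section Pieri.
Variables (R : comNzRingType) (h : int -> R) (D : nat).
Hypothesis h0 : h 0 = 1.
Hypothesis hN : forall z : int, z < 0 -> h z = 0.
Hypothesis hD : forall z : int, D%:Z < z -> h z = 0.
Variable N : nat.
Implicit Types a b : bpart N D.

Definition sjt a : R := jt h N.+1 (fun i => a (inord i)).

Lemma sjtE a :
  sjt a = \det (\matrix_(i < N.+1, j < N.+1) h ((a i + j)%:Z - (i : nat)%:Z)).
Proof.
by congr (\det _); apply/matrixP => i j; rewrite !mxE inord_val.
Qed.

(** Since [h] vanishes above [D], [K] terms give the whole generating polynomial [G z] for every
    [z >= -N], which covers all entries [a i + j - i]. *)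
Let K := (D + N).+3.

Let G (z : int) : {poly R} := \sum_(v < K) (h (z + v%:Z))%:P * 'X^v.

Let G_rec (z : int) : - N%:Z <= z + 1 -> G z = (h z)%:P + 'X * G (z + 1).
Proof.
move=> Nz; rewrite /G {1}/K big_ord_recl addr0 mulr1; congr (_ + _).
rewrite [in RHS]/K [in RHS]big_ord_recr /= hD; last by lia.
rewrite mul0r addr0 mulr_sumr. apply: eq_bigr => v _.
by rewrite /bump /= exprS mulrCA; congr ('X * ((h _)%:P * _)); lia.
Qed.

Let Gtrunc (z : int) (d : nat) : - N%:Z <= z ->
  G z = \sum_(v < d) (h (z + v%:Z))%:P * 'X^v + 'X^d * G (z + d%:Z).
Proof.
move=> Nz; elim: d => [|d IHd]; first by rewrite big_ord0 add0r mul1r addr0.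
rewrite big_ord_recr /= IHd (@G_rec (z + d%:Z)); last by lia.
rewrite -[RHS]addrA; congr (_ + _); rewrite mulrDr [_ * (h _)%:P]mulrC mulrA -exprSr.
by congr (_ + _ * G _); lia.
Qed.

(** The possible lengths of one row of a strip form an interval, so their generating polynomial is a
    difference of two values of [G]; in [pieri] this becomes a row operation. *)
Let Gsum (z : int) (x y : nat) : (x <= y)%N -> - N%:Z <= x%:Z + z ->
  \sum_(x <= v < y) (h (v%:Z + z))%:P * 'X^(v - x) =
  G (x%:Z + z) - 'X^(y - x) * G (y%:Z + z).
Proof.
move=> xy xz; rewrite (@Gtrunc (x%:Z + z) (y - x)) //.
rewrite [in X in _ * G X](_ : _ + _ = y%:Z + z) ?addrK; last by lia.
rewrite -{1}(add0n x) big_addn big_mkord; apply: eq_bigr => v _.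
by rewrite addnK; congr ((h _)%:P * _); lia.
Qed.

Let Gbig (z : int) : D%:Z < z -> G z = 0.
Proof.
by move=> Dz; rewrite /G big1 // => v _; rewrite hD ?mul0r //; lia.
Qed.

Let sum_interval (F : nat -> {poly R}) (x y : nat) : (y <= D.+1)%N ->
  \sum_(v : 'I_D.+1 | (x <= v < y)%N) F v = \sum_(x <= v < y) F v.
Proof.
move=> yD; rewrite (big_nat_widen _ _ _ _ _ yD) (big_nat_widenl _ _ _ _ _ (leq0n x)).
by rewrite big_mkord; apply: eq_bigl => v; rewrite /= andbC.
Qed.

(* With [G z] the generating polynomial of the [h (z + v)], the generating polynomial of the left side
   is the determinant of the [G (a i + j - i)] up to unitriangular row operations, and the right side
   is the same determinant up to unitriangular column operations. *)
Lemma pieri a (d : int) : hstrip a a -> a ord_max = 0%N :> nat ->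
  \sum_(b | hstrip a b && (weight b - weight a == d)) sjt b = h d * sjt a.
Proof.
move=> /hstripP[_ a_dec] aN.
(* [P k] selects the lengths allowed for row [k] of [b], so that by multilinearity [\det Q] sums
   over all strips, with ['X] recording the size. *)
pose P (k : 'I_N.+1) (x : 'I_D.+1) :=
  (a k <= x)%N && ((0 < k)%N ==> (x <= a (inord k.-1))%N).
pose Q : 'M[{poly R}]_N.+1 := \matrix_(i < N.+1, j < N.+1) \sum_(x | P i x)
   ((h ((x + j)%:Z - (i : nat)%:Z))%:P * 'X^(x - a i)).
pose GM := \matrix_(i < N.+1, j < N.+1) G ((a i + j)%:Z - (i : nat)%:Z).
pose L : 'M[{poly R}]_N.+1 := \matrix_(i < N.+1, j < N.+1)
  ((i == j)%:R - (j.+1 == i :> nat)%:R * 'X^((a j).+1 - a i)).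
pose U : 'M[{poly R}]_N.+1 := \matrix_(i < N.+1, j < N.+1)
  ((i == j)%:R - (j.+1 == i :> nat)%:R * 'X).
have detL : \det L = 1.
  rewrite det_trig; last first.
    apply/is_trig_mxP => i j ij; rewrite mxE -val_eqE /=.
    by rewrite (ltn_eqF ij) gtn_eqF ?mul0r ?subr0 // ltnW.
  by rewrite big1 // => i _; rewrite mxE eqxx gtn_eqF // mul0r subr0.
have detU : \det U = 1.
  rewrite det_trig; last first.
    apply/is_trig_mxP => i j ij; rewrite mxE -val_eqE /=.
    by rewrite (ltn_eqF ij) gtn_eqF ?mul0r ?subr0 // ltnW.
  by rewrite big1 // => i _; rewrite mxE eqxx gtn_eqF // mul0r subr0.
have QE : Q = L *m GM.
  apply/matrixP => i j; rewrite !mxE.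
  have -> : \sum_k L i k * GM k j = GM i j -
      \sum_(k : 'I_N.+1 | k.+1 == i :> nat) 'X^((a k).+1 - a i) * GM k j.
    rewrite (bigD1 i) //= [L i i]mxE eqxx gtn_eqF // mul0r subr0 mul1r.
    congr (_ + _); rewrite -sumrN big_mkcond [RHS]big_mkcond; apply: eq_bigr => k _.
    case: eqP => [->|/eqP ki] /=; first by rewrite gtn_eqF.
    rewrite [L i k]mxE eq_sym (negPf ki) sub0r.
    by case: eqP => _; rewrite ?mul1r ?mul0r ?oppr0 ?mul0r ?mulNr.
  have ij : - N%:Z <= ((j : nat)%:Z - (i : nat)%:Z) by have := ltn_ord i; lia.
  pose z := (j : nat)%:Z - (i : nat)%:Z.
  have GMij (k : nat) (i' : int) : G (k%:Z + z) = G ((k + j)%:Z - (i : nat)%:Z).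
    by congr (G _); rewrite /z; lia.
  pose F (v : nat) := (h (v%:Z + z))%:P * 'X^(v - a i).
  rewrite (eq_bigr (fun x : 'I_D.+1 => F x)) => [|x _]; last first.
    by congr ((h _)%:P * _); rewrite /z; lia.
  have ai := ltn_ord (a i).
  case: (posnP i) => [i0|i0].
    rewrite (eq_bigl (fun x : 'I_D.+1 => (a i <= x < D.+1)%N)); last first.
      by move=> x; rewrite /P i0 ltn_ord.
    (* Cutting the top row off at [D] loses nothing: in row 0 the omitted terms are values of [h]
       above [D]. *)
    rewrite sum_interval // Gsum ?[G (D.+1%:Z + z)]Gbig; try by rewrite /z; lia.
    rewrite mulr0 subr0 big_pred0 ?subr0 ?mxE; first by congr G; rewrite /z; lia.
    by move=> k; rewrite i0.
  pose i' : 'I_N.+1 := inord i.-1.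
  have i'E : i'.+1 = i by rewrite inordK prednK // ltnW.
  have aa := a_dec i' i (esym i'E).
  rewrite (eq_bigl (fun x : 'I_D.+1 => (a i <= x < (a i').+1)%N)); last first.
    by move=> x; rewrite /P i0 ltnS.
  rewrite sum_interval ?ltn_ord // Gsum ?ltnS ?(leqW aa); try by rewrite /z; lia.
  rewrite (big_pred1 i') => [|k]; last by rewrite /= -i'E eqSS.
  by rewrite !mxE; congr (G _ - _ * G _); rewrite /z; lia.
have GUE (i j : 'I_N.+1) : (GM *m U) i j =
   if j == ord_max then G ((a i + j)%:Z - (i : nat)%:Z)
   else (h ((a i + j)%:Z - (i : nat)%:Z))%:P.
  have -> : (GM *m U) i j = GM i j -
      \sum_(k : 'I_N.+1 | j.+1 == k :> nat) 'X * GM i k.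
    rewrite mxE (bigD1 j) //= [U j j]mxE eqxx gtn_eqF // mul0r subr0 mulr1.
    congr (_ + _); rewrite -sumrN big_mkcond [RHS]big_mkcond; apply: eq_bigr => k _.
    case: eqP => [->|/eqP ki] /=; first by rewrite gtn_eqF.
    rewrite [U k j]mxE (negPf ki) sub0r mulrC.
    by case: eqP => _; rewrite ?mul1r ?mul0r ?oppr0 ?mul0r ?mulNr.
  rewrite mxE; case: eqP => [->|/eqP jN].
    by rewrite big_pred0 ?subr0 // => k; rewrite gtn_eqF //= ltn_ord.
  have jN' : (j.+1 < N.+1)%N.
    by have := ltn_ord j; move: jN; rewrite -val_eqE /=; lia.
  rewrite (big_pred1 (Ordinal jN')) => [|k]; last by rewrite /= -val_eqE eq_sym.
  rewrite mxE G_rec; last by have := ltn_ord i; lia.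
  have -> : (a i + j)%:Z - (i : nat)%:Z + 1 = (a i + j.+1)%:Z - (i : nat)%:Z by lia.
  by rewrite addrK.
(* After the column operations only the last column contains [G]; since row [ord_max] of [a] is
   empty, the last row vanishes up to its corner [G 0]. *)
have detQ : \det Q = G 0 * (sjt a)%:P.
  rewrite QE det_mulmx detL mul1r -[LHS]mulr1 -detU -det_mulmx.
  rewrite det_last_row => [|j jN]; last first.
    rewrite GUE (negPf jN) aN hN //.
    by have := ltn_ord j; move: jN; rewrite -val_eqE /=; lia.
  rewrite GUE eqxx aN add0n subrr; congr (_ * _).
  rewrite sjtE det_last_row => [|j jN]; last first.
    rewrite mxE aN hN //.
    by have := ltn_ord j; move: jN; rewrite -val_eqE /=; lia.
  rewrite mxE aN add0n subrr h0 mul1r -det_map_mx; congr (\det _).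
  apply/matrixP => i j; rewrite 2!mxE GUE !mxE.
  by rewrite -val_eqE /= /bump leqNgt ltn_ord add0n ltn_eqF.
have detQ' : \det Q = \sum_(b | hstrip a b) (sjt b)%:P * 'X^(`|weight b - weight a|%N).
  rewrite det_sum_rows; apply: eq_big => [b|b].
    by apply/forallP/forallP.
  move=> /forallP ab; rewrite sjtE -det_map_mx.
  pose W : 'M[{poly R}]_N.+1 := diag_mx (\row_i 'X^(b i - a i)).
  transitivity (\det (W *m (map_mx polyC
     (\matrix_(i < N.+1, j < N.+1) h ((b i + j)%:Z - (i : nat)%:Z))))).
    by congr (\det _); apply/matrixP => i j; rewrite mul_diag_mx !mxE mulrC.
  rewrite det_mulmx det_diag mulrC; congr (_ * _).
  under eq_bigr do rewrite mxE.
  rewrite -expr_sum; congr (_ ^+ _).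
  rewrite /weight -sumrB.
  rewrite (eq_bigr (fun k => (b k - a k)%N%:Z)) => [|k _]; last first.
    by have /andP[abk _] := ab k; rewrite -subzn.
  by rewrite -(big_morph Posz PoszD (erefl 0%:Z)).
have wab b : hstrip a b -> 0 <= weight b - weight a.
  move=> /hstripP[ab _]; rewrite /weight -sumrB sumr_ge0 // => k _.
  by have := ab k; lia.
case: d => d; last first.
  rewrite hN // mul0r big1 // => b /andP[/wab]; lia.
transitivity (G 0 * (sjt a)%:P)`_d.
  rewrite -detQ detQ' coef_sum big_mkcondr; apply: eq_bigr => b /wab ab.
  rewrite coefCM coefXn; case: ifP => [/eqP->|/eqP dE] /=; first by rewrite eqxx mulr1.
  by case: eqP => [|_]; rewrite ?mulr0 //; lia.
rewrite coefMC; congr (_ * _).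
rewrite /G coef_sum; under eq_bigr do rewrite coefCM coefXn add0r.
have [dK|Kd] := ltnP d K.
  rewrite (bigD1 (Ordinal dK)) //= eqxx mulr1 big1 ?addr0 // => v.
  by rewrite -val_eqE eq_sym /= => /negPf ->; rewrite mulr0.
rewrite hD ?big1 // => [v _|]; last by rewrite /K in Kd; lia.
by rewrite gtn_eqF ?mulr0 // (leq_trans _ Kd).
Qed.

End Pieri.

(** * Crystal operators on two consecutive strips *)

Section Argmin.
Variable N : nat.
Implicit Types (g : 'I_N.+1 -> int) (i j : 'I_N.+1).

Definition is_first_min g j : bool :=
  [forall i, (g j <= g i) && ((i < j)%N ==> (g j < g i))].
Definition is_last_min g j : bool :=
  [forall i, (g j <= g i) && ((j < i)%N ==> (g j < g i))].
(** The default [ord0] is never taken, since a minimum is always attained. *)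
Definition first_min g : 'I_N.+1 := odflt ord0 [pick j | is_first_min g j].
Definition last_min g : 'I_N.+1 := odflt ord0 [pick j | is_last_min g j].

Lemma first_minP g : is_first_min g (first_min g).
Proof.
rewrite /first_min; case: pickP => //= none.
case: (arg_minP (P := predT) g (isT : predT (ord0 : 'I_N.+1))) => j0 _ j0min.
case: (arg_minnP (P := fun j => g j == g j0) val (eqxx (g j0))) => j /eqP jE jmin.
case/negP: (negbT (none j)); apply/forallP => i; rewrite jE j0min //=.
apply/implyP => ij; rewrite lt_neqAle j0min // andbT.
by apply/negP; rewrite eq_sym => /jmin; rewrite leqNgt ij.
Qed.

Lemma last_minP g : is_last_min g (last_min g).
Proof.
rewrite /last_min; case: pickP => //= none.
case: (arg_minP (P := predT) g (isT : predT (ord0 : 'I_N.+1))) => j0 _ j0min.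
case: (arg_maxnP (P := fun j => g j == g j0) val (eqxx (g j0))) => j /eqP jE jmax.
case/negP: (negbT (none j)); apply/forallP => i; rewrite jE j0min //=.
apply/implyP => ij; rewrite lt_neqAle j0min // andbT.
by apply/negP; rewrite eq_sym => /jmax /=; rewrite leqNgt ij.
Qed.

Lemma first_min_uniq g j : is_first_min g j -> first_min g = j.
Proof.
move=> /forallP jmin; have /forallP kmin := first_minP g.
apply/val_inj; have /andP[j1 j2] := jmin (first_min g); have /andP[k1 k2] := kmin j.
by case: ltngtP j2 k2 => //= *; lia.
Qed.

Lemma last_min_uniq g j : is_last_min g j -> last_min g = j.
Proof.
move=> /forallP jmin; have /forallP kmin := last_minP g.
apply/val_inj; have /andP[j1 j2] := jmin (last_min g); have /andP[k1 k2] := kmin j.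
by case: ltngtP j2 k2 => //= *; lia.
Qed.

End Argmin.

Section Moves.
Variables N D : nat.
Implicit Types (a b c z : bpart N D) (i j k : 'I_N.+1).

(* With a [b/a]-box opening and a [c/b]-box closing a bracket, and rows read from the top, the number
   of matched pairs is the minimum of [cut a b c] over the rows. *)
Definition cut a b c j : int :=
  \sum_(k < N.+1) (if (k < j)%N then (b k : nat)%:Z - (a k : nat)%:Z else
          if (j < k)%N then (c k : nat)%:Z - (b k : nat)%:Z else 0).

Definition bad a b c (r : int) : bool := [exists j, cut a b c j <= r].

Definition set_row b j (v : nat) : bpart N D :=
  [ffun k => if k == j then inord v else b k].

(** Crystal operators with [a] and [c] fixed. When there is one, [raise] turns the last unmatched
    closing bracket, which lies in the first row where [cut] is minimal, into an opening one;
    [lower] turns the first unmatched opening bracket, in the last such row, into a closing one. *)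
Definition raise a b c :=
  let j := first_min (cut a b c) in set_row b j (b j).+1.
Definition lower a b c :=
  let j := last_min (cut a b c) in set_row b j (b j).-1.

Lemma cut_box a b b' c j0 j :
  (forall k, (b' k : nat)%:Z = (b k : nat)%:Z + (k == j0)%:Z) ->
  cut a b' c j = cut a b c j + (j0 < j)%N%:Z - (j < j0)%N%:Z.
Proof.
move=> bE; apply/eqP; rewrite -subr_eq0 -addrA opprD addrA /cut -sumrB.
rewrite (bigD1 j0) //= big1 => [|k /negPf kj]; rewrite bE ?kj ?eqxx; last first.
  by case: ifP => _; [|case: ifP => _]; lia.
by case: (ltngtP j0 j) => /= _; lia.
Qed.

Lemma weight_box b b' j0 :
  (forall k, (b' k : nat)%:Z = (b k : nat)%:Z + (k == j0)%:Z) ->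
  weight b' = weight b + 1.
Proof.
move=> bE; rewrite /weight (eq_bigr _ (fun k _ => bE k)) big_split /=.
congr (_ + _); rewrite (bigD1 j0) //= eqxx big1 // => k /negPf -> //.
Qed.

Lemma cut_succ a b c j j' : j' = j.+1 :> nat ->
  cut a b c j' - cut a b c j =
  ((b j : nat)%:Z - (a j : nat)%:Z) - ((c j' : nat)%:Z - (b j' : nat)%:Z).
Proof.
move=> j'E; have j'j : j' != j by rewrite -val_eqE /= j'E gtn_eqF.
rewrite /cut -sumrB (bigD1 j) //= (bigD1 j') //= big1 => [|k /andP[kj kj']].
  by rewrite !j'E !ltnn ltnSn ltnNge leqnSn /=; lia.
move: kj kj'; rewrite -!val_eqE /= j'E => kj kj'.
by case: (ltngtP k j) kj => //= kj _; case: (ltngtP k j.+1) kj' => //= kj' _; lia.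
Qed.

Lemma cut_first a b c :
  cut a b c ord0 = weight c - weight b - ((c ord0 : nat)%:Z - (b ord0 : nat)%:Z).
Proof.
rewrite /cut /weight -sumrB [in RHS](bigD1 ord0) // [in LHS](bigD1 ord0) //=.
rewrite add0r addrAC subrr add0r; apply: eq_bigr => k.
by rewrite -val_eqE /= -lt0n => ->.
Qed.

Lemma cut_last a b c :
  cut a b c ord_max =
  weight b - weight a - ((b ord_max : nat)%:Z - (a ord_max : nat)%:Z).
Proof.
rewrite /cut /weight -sumrB [in RHS](bigD1 ord_max) // [in LHS](bigD1 ord_max) //=.
rewrite ltnn add0r addrAC subrr add0r; apply: eq_bigr => k.
by rewrite -val_eqE /= => kN; rewrite ltn_neqAle kN -ltnS ltn_ord.
Qed.

(** [cut] drops strictly on reaching its first minimum. By [cut_succ], row [j0] of [c/b] is then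
    nonempty and the preceding row of [a] is long enough for the new box; in the top row the bound
    on the cut gives the former. *)
Lemma raise_box a b c : hstrip a b -> hstrip b c ->
  cut a b c (first_min (cut a b c)) < weight c - weight b ->
  let b' := raise a b c in let j0 := first_min (cut a b c) in
  [/\ forall k, (b' k : nat)%:Z = (b k : nat)%:Z + (k == j0)%:Z,
      hstrip a b', hstrip b' c & lower a b' c = b].
Proof.
move=> /hstripP[ab ba] /hstripP[bc cb] small b' j0.
have jmin := forallP (first_minP (cut a b c)); rewrite -/j0 in small jmin.
have bc0 : (b j0 < c j0)%N.
  have [j00|j00] := posnP j0.
    by move: small; rewrite (_ : j0 = ord0) ?cut_first; [lia|apply/val_inj].
  have /andP[_] := jmin (inord j0.-1).
  have jE : j0 = (inord j0.-1 : 'I_N.+1).+1 :> nat.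
    by rewrite inordK prednK // ltnW.
  have lt0 : ((inord j0.-1 : 'I_N.+1) < j0)%N by rewrite [X in (_ < X)%N]jE.
  rewrite lt0 /= -subr_gt0 => lt.
  by have := cut_succ a b c jE; have := ab (inord j0.-1); lia.
have b'E k : (b' k : nat)%:Z = (b k : nat)%:Z + (k == j0)%:Z.
  rewrite ffunE -/j0; case: (k =P j0) => [->|_] /=; last by rewrite addr0.
  by rewrite inordK; [lia|have := ltn_ord (c j0); lia].
have ab' : hstrip a b'.
  apply/hstripP; split=> [k|k k' k'E]; first by have := b'E k; have := ab k; lia.
  have := b'E k'; case: (k' =P j0) => [k'j0|_] /=; last by have := ba _ _ k'E; lia.
  have /andP[_] := jmin k; rewrite -k'j0 k'E ltnSn /= => lt.
  by have := cut_succ a b c k'E; have := cb _ _ k'E; lia.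
have b'c : hstrip b' c.
  apply/hstripP; split=> [k|k k' k'E].
    have := b'E k; case: (k =P j0) => [->|_] /=; first lia.
    by have := bc k; lia.
  by have := b'E k; have := cb _ _ k'E; lia.
(* The new box adds one to the cuts after [j0] and takes one from those before it, so the first
   minimum of [cut] becomes the last. *)
split=> //; rewrite /lower (@last_min_uniq _ _ j0).
  apply/ffunP => k; rewrite ffunE; case: eqP => [->|/eqP kj]; apply/val_inj.
    have := b'E j0; rewrite eqxx /= => E.
    by rewrite inordK; [lia|have := ltn_ord (b' j0); lia].
  by have := b'E k; rewrite (negPf kj) /=; lia.
apply/forallP => i; rewrite !(cut_box _ _ _ b'E) ltnn.
have /andP[] := jmin i; case: (ltngtP i j0) => //= ij; lia.
Qed.

(** Mirror image of [raise_box]: [cut] rises strictly after its last minimum. *)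
Lemma lower_box a b c : hstrip a b -> hstrip b c ->
  cut a b c (last_min (cut a b c)) < weight b - weight a ->
  let b' := lower a b c in let j0 := last_min (cut a b c) in
  [/\ forall k, (b k : nat)%:Z = (b' k : nat)%:Z + (k == j0)%:Z,
      hstrip a b', hstrip b' c & raise a b' c = b].
Proof.
move=> /hstripP[ab ba] /hstripP[bc cb] small b' j0.
have jmin := forallP (last_minP (cut a b c)); rewrite -/j0 in small jmin.
have ab0 : (a j0 < b j0)%N.
  have [j00|j00] := eqVneq j0 ord_max.
    by move: small; rewrite j00 cut_last; lia.
  have jN : (j0.+1 < N.+1)%N.
    by have := ltn_ord j0; move: j00; rewrite -val_eqE /=; lia.
  have /andP[_] := jmin (Ordinal jN); rewrite /= ltnSn /= -subr_gt0 => lt.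
  by have := @cut_succ a b c j0 (Ordinal jN) erefl; have := bc (Ordinal jN); lia.
have b'E k : (b k : nat)%:Z = (b' k : nat)%:Z + (k == j0)%:Z.
  rewrite ffunE -/j0; case: (k =P j0) => [->|_] /=; last by rewrite addr0.
  by rewrite inordK; [lia|have := ltn_ord (b j0); lia].
have ab' : hstrip a b'.
  apply/hstripP; split=> [k|k k' k'E].
    have := b'E k; case: (k =P j0) => [->|_] /=; first lia.
    by have := ab k; lia.
  by have := b'E k'; have := ba _ _ k'E; lia.
have b'c : hstrip b' c.
  apply/hstripP; split=> [k|k k' k'E]; first by have := b'E k; have := bc k; lia.
  have := b'E k; case: (k =P j0) => [kj0|_] /=; last by have := cb _ _ k'E; lia.
  have /andP[_] := jmin k'; rewrite -kj0 k'E ltnSn /= => lt.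
  by have := cut_succ a b c k'E; have := ba _ _ k'E; lia.
split=> //; rewrite /raise (@first_min_uniq _ _ j0).
  apply/ffunP => k; rewrite ffunE; case: eqP => [->|/eqP kj]; apply/val_inj.
    have := b'E j0; rewrite eqxx /= => E.
    by rewrite inordK; [lia|have := ltn_ord (b j0); lia].
  by have := b'E k; rewrite (negPf kj) /=; lia.
apply/forallP => i; have := cut_box a c j0 b'E; have := cut_box a c i b'E.
rewrite ltnn => E1 E2.
have /andP[] := jmin i; case: (ltngtP i j0) E1 E2 => //= ij; lia.
Qed.

Lemma bad_first_min a b c r : bad a b c r -> cut a b c (first_min (cut a b c)) <= r.
Proof.
case/existsP => j; apply: le_trans.
by have /andP[] := forallP (first_minP (cut a b c)) j.
Qed.

Lemma bad_last_min a b c r : bad a b c r -> cut a b c (last_min (cut a b c)) <= r.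
Proof.
case/existsP => j; apply: le_trans.
by have /andP[] := forallP (last_minP (cut a b c)) j.
Qed.

(** The cut in the row of the new box does not change, so badness persists for the same [r]. *)
Lemma raiseP a b c r : hstrip a b -> hstrip b c -> bad a b c r ->
  r < weight c - weight b ->
  [/\ hstrip a (raise a b c), hstrip (raise a b c) c,
      weight (raise a b c) = weight b + 1, bad a (raise a b c) c r
    & lower a (raise a b c) c = b].
Proof.
move=> ab bc /bad_first_min le lt.
have [bE ab' b'c K] := raise_box ab bc (le_lt_trans le lt).
split=> //; first exact: weight_box bE.
by apply/existsP; exists (first_min (cut a b c)); rewrite (cut_box _ _ _ bE) ltnn; lia.
Qed.

Lemma lowerP a b c r : hstrip a b -> hstrip b c -> bad a b c r ->
  r < weight b - weight a ->
  [/\ hstrip a (lower a b c), hstrip (lower a b c) c,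
      weight b = weight (lower a b c) + 1, bad a (lower a b c) c r
    & raise a (lower a b c) c = b].
Proof.
move=> ab bc /bad_last_min le lt.
have [bE ab' b'c K] := lower_box ab bc (le_lt_trans le lt).
split=> //; first exact: weight_box bE.
apply/existsP; exists (last_min (cut a b c)).
by have := cut_box a c (last_min (cut a b c)) bE; rewrite ltnn; lia.
Qed.

(* If the cuts at rows [j'] (strips [z/a], [a/b]) and [j] (strips [a/b], [b/c])
   are small, their sum is less than the size of [a/b], which forces [j <= j']:
   the box added in row [j] is not seen by the cut at [j']. *)
Lemma bad_raise_prev z a b c r0 r : hstrip a b -> hstrip b c ->
  hstrip z a -> bad z a b r0 -> bad a b c r ->
  r < weight c - weight b -> r0 + r < weight b - weight a ->
  bad z a (raise a b c) r0.
Proof.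
move=> ab bc /hstripP[za _] /existsP[j' j'r] /bad_first_min jr lt lt2.
have [bE _ _ _] := raise_box ab bc (le_lt_trans jr lt).
have [{}ab _] := hstripP _ _ ab; have [{}bc _] := hstripP _ _ bc.
apply/existsP; exists j'; set j := first_min _ in jr bE.
have jj' : (j <= j')%N.
  rewrite leqNgt; apply/negP => j'j.
  (* If [j' < j], every row lies below [j'] or above [j], so each box of [b/a] is counted by one of
     the two cuts. *)
  have : weight b - weight a <= cut z a b j' + cut a b c j.
    rewrite /weight /cut -sumrB -big_split; apply: ler_sum => k _ /=.
    have := ab k; have := bc k; have := za k.
    by case: (ltngtP k j) => ?; case: (ltngtP k j') => ?; lia.
  by lia.
rewrite (le_trans _ j'r) // ler_sum // => k _.
case: ifP => // _; case: ifP => // j'k; rewrite bE (_ : k == j = false) ?addr0 //.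
by apply/negP => /eqP kj; move: j'k jj'; rewrite kj; lia.
Qed.

(** Fewer closing brackets cannot increase a cut. Hence lowering at one place preserves badness at
    the preceding one. *)
Lemma bad_mono z a b b' r : (forall k, (b k <= b' k)%N) ->
  bad z a b' r -> bad z a b r.
Proof.
move=> bb' /existsP[j jr]; apply/existsP; exists j; apply: le_trans jr.
apply: ler_sum => k _; case: ifP => // _; case: ifP => // _.
by have := bb' k; lia.
Qed.

Lemma lower_le a b c r : hstrip a b -> hstrip b c -> bad a b c r ->
  r < weight b - weight a -> forall k, (lower a b c k <= b k)%N.
Proof.
move=> ab bc /bad_last_min le lt k.
have [bE _ _ _] := lower_box ab bc (le_lt_trans le lt).
by have := bE k; lia.
Qed.

(** The cut at the top row counts only boxes of [c/b]. *)
Lemma bad_weight a b c r : hstrip b c -> weight c - weight b <= r -> bad a b c r.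
Proof.
move=> /hstripP[bc _] le; apply/existsP; exists ord0; rewrite cut_first.
by have := bc ord0; lia.
Qed.

End Moves.

(** * Chains of strips *)

Definition empty_part (N D : nat) : bpart N D := [ffun=> ord0].

Lemma hstrip_refl N D (a b : bpart N D) : hstrip a b -> hstrip b b.
Proof.
move=> /hstripP[ab ba]; apply/hstripP; split=> // k k' /ba le.
exact: leq_trans le (ab k).
Qed.

Lemma hstrip_empty N D : hstrip (empty_part N D) (empty_part N D).
Proof. by apply/hstripP; split=> *; rewrite !ffunE. Qed.

Section Chains.
Variables L N D : nat.
Definition chain := {ffun 'I_L.+1 -> bpart N D}.
Implicit Types (X Y : chain) (b : bpart N D) (g r : nat -> int).

Definition lev X (l : nat) : bpart N D := X (inord l).

Definition set_lev X (l : nat) b : chain :=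
  [ffun i => if i == inord l then b else X i].

(** Emptying the levels after the [m]-th makes a chain determined by its first [m] strips, which
    allows induction on [m]. *)
Definition is_chain (m : nat) g X : bool :=
  (lev X 0 == empty_part N D) &&
  [forall l : 'I_L, if (l < m)%N then
     hstrip (lev X l) (lev X l.+1) && (weight (lev X l.+1) - weight (lev X l) == g l)
   else lev X l.+1 == empty_part N D].

(** At the last [i] the level [i.+2] is out of range and [lev] returns junk; the sets [Q] used below
    avoid that place. *)
Definition all_bad (Q : pred nat) r X : bool :=
  [forall i : 'I_L, Q i ==> bad (lev X i) (lev X i.+1) (lev X i.+2) (r i)].

Lemma is_chainP m g X : reflect
  [/\ lev X 0 = empty_part N D,
      forall l, (l < L)%N -> (l < m)%N -> hstrip (lev X l) (lev X l.+1),
      forall l, (l < L)%N -> (l < m)%N -> weight (lev X l.+1) - weight (lev X l) = g l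
    & forall l, (l < L)%N -> (m <= l)%N -> lev X l.+1 = empty_part N D]
  (is_chain m g X).
Proof.
apply: (iffP andP) => [[/eqP X0 /forallP X1]|[X0 X1 X2 X3]]; split=> //.
- by move=> l lL lm; have := X1 (Ordinal lL); rewrite /= lm => /andP[].
- by move=> l lL lm; have := X1 (Ordinal lL); rewrite /= lm => /andP[_ /eqP].
- by move=> l lL lm; have := X1 (Ordinal lL); rewrite /= ltnNge lm => /eqP.
- by rewrite X0.
apply/forallP => l; case: ltnP => lm; last by rewrite X3.
by rewrite X1 //= X2.
Qed.

Lemma all_badP (Q : pred nat) r X : reflect
  (forall i, (i < L)%N -> Q i -> bad (lev X i) (lev X i.+1) (lev X i.+2) (r i))
  (all_bad Q r X).
Proof.
apply: (iffP forallP) => [XQ i iL Qi|XQ i]; last by apply/implyP; exact: XQ.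
by have /implyP := XQ (Ordinal iL); apply.
Qed.

Lemma lev_set X l b l' : (l <= L)%N -> (l' <= L)%N ->
  lev (set_lev X l b) l' = if l' == l then b else lev X l'.
Proof.
by move=> lL l'L; rewrite /lev ffunE -val_eqE /= !inordK.
Qed.

Lemma set_lev_id X l b : lev X l = b -> set_lev X l b = X.
Proof. by move=> <-; apply/ffunP => i; rewrite ffunE; case: eqP => [->|]. Qed.

Lemma set_set_lev X l b b' : set_lev (set_lev X l b) l b' = set_lev X l b'.
Proof. by apply/ffunP => i; rewrite !ffunE; case: eqP. Qed.

(** * Moving boxes between neighbouring strips of a chain *)

Section Move.
Variables (r : nat -> int) (j : nat) (Q : pred nat).
Hypotheses (jL : (j.+1 < L)%N) (Qj : Q j) (Q_le : forall i, Q i -> (i <= j)%N).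

Definition raise_at X := set_lev X j.+1 (raise (lev X j) (lev X j.+1) (lev X j.+2)).
Definition lower_at X := set_lev X j.+1 (lower (lev X j) (lev X j.+1) (lev X j.+2)).

Lemma is_chain_set g g' X b : is_chain L g X ->
  hstrip (lev X j) b -> hstrip b (lev X j.+2) ->
  g' j = weight b - weight (lev X j) -> g' j.+1 = weight (lev X j.+2) - weight b ->
  (forall i, i != j -> i != j.+1 -> g' i = g i) ->
  is_chain L g' (set_lev X j.+1 b).
Proof.
move=> /is_chainP[X0 X1 X2 X3] ab bc g'j g'j1 g'E.
have jL1 : (j.+1 <= L)%N by apply: ltnW.
apply/is_chainP; split=> [|l lL _|l lL _|l]; first by rewrite lev_set.
- rewrite !lev_set ?(ltnW lL) //.
  case: (eqVneq l j.+1) => [->|lj1]; first by rewrite gtn_eqF.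
  by rewrite eqSS; case: (eqVneq l j) => [->|lj]; last exact: X1.
- rewrite !lev_set ?(ltnW lL) //.
  case: (eqVneq l j.+1) => [->|lj1]; first by rewrite gtn_eqF.
  by rewrite eqSS; case: (eqVneq l j) => [->|lj]; rewrite ?g'j // g'E // X2.
by rewrite ltnNge => /negPf ->.
Qed.

(** Level [j.+1] is seen only from the places [j - 1], [j] and [j.+1], and the last is not in
    [Q]. *)
Lemma all_bad_set X b : all_bad Q r X ->
  bad (lev X j) b (lev X j.+2) (r j) ->
  (forall i, j = i.+1 -> Q i -> bad (lev X i) (lev X j) b (r i)) ->
  all_bad Q r (set_lev X j.+1 b).
Proof.
move=> /all_badP XQ Xj Xi; apply/all_badP => i iL Qi.
have ij := Q_le Qi; have jL1 : (j.+1 <= L)%N by apply: ltnW.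
rewrite !lev_set //; try lia.
rewrite (_ : i == j.+1 = false); last by lia.
rewrite eqSS; case: (eqVneq i j) => [->|nij]; first by rewrite gtn_eqF.
rewrite eqSS; case: (eqVneq i.+1 j) => [ji|nij']; last exact: XQ.
by rewrite ji; apply: Xi; rewrite ?ji.
Qed.

Variables g g' : nat -> int.
Hypotheses (g'j : g' j = g j + 1) (g'j1 : g' j.+1 = g j.+1 - 1).
Hypothesis g'E : forall i, i != j -> i != j.+1 -> g' i = g i.
Hypotheses (rg : r j < g j.+1) (rg' : r j <= g j).
Hypothesis rr : forall i, j = i.+1 -> r i + r j < g j.

Lemma raise_atP X : is_chain L g X -> all_bad Q r X ->
  [/\ is_chain L g' (raise_at X), all_bad Q r (raise_at X)
    & lower_at (raise_at X) = X].
Proof.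
move=> Xc Xb; have /is_chainP[X0 X1 X2 _] := Xc; have /all_badP XQ := Xb.
have jL1 : (j < L)%N by apply: ltnW.
have ab := X1 j jL1 jL1; have bc := X1 j.+1 jL jL.
have Eab := X2 j jL1 jL1; have Ebc := X2 j.+1 jL jL.
have abc := XQ j jL1 Qj.
have rg2 : r j < weight (lev X j.+2) - weight (lev X j.+1) by rewrite Ebc.
have [ab' b'c wb' abc' K] := raiseP ab bc abc rg2.
rewrite /raise_at; split.
- apply: is_chain_set Xc _ _ _ _ _ => //; first by rewrite g'j wb' -Eab; lia.
  by rewrite g'j1 wb' -Ebc; lia.
(* At the place [j - 1], [rr] says that the two thresholds add up to less than the size of strip
   [j], as [bad_raise_prev] requires. *)
- apply: all_bad_set => // i ji Qi.
  have iL : (i < L)%N by lia.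
  have za := X1 i iL iL; have := XQ i iL Qi; rewrite -ji in za * => zab.
  apply: bad_raise_prev abc rg2 _ => //.
  by rewrite Eab; apply: rr.
rewrite /lower_at !lev_set //; try lia.
rewrite eqxx ltn_eqF // gtn_eqF // K set_set_lev.
exact: set_lev_id.
Qed.

Lemma lower_atP X : is_chain L g' X -> all_bad Q r X ->
  [/\ is_chain L g (lower_at X), all_bad Q r (lower_at X)
    & raise_at (lower_at X) = X].
Proof.
move=> Xc Xb; have /is_chainP[X0 X1 X2 _] := Xc; have /all_badP XQ := Xb.
have jL1 : (j < L)%N by apply: ltnW.
have ab := X1 j jL1 jL1; have bc := X1 j.+1 jL jL.
have Eab := X2 j jL1 jL1; have Ebc := X2 j.+1 jL jL.
have abc := XQ j jL1 Qj.
have rg2 : r j < weight (lev X j.+1) - weight (lev X j) by rewrite Eab g'j; lia.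
have [ab' b'c wb' abc' K] := lowerP ab bc abc rg2.
have le := lower_le ab bc abc rg2.
rewrite /lower_at; split.
- apply: is_chain_set Xc _ _ _ _ _ => //.
  + by move: Eab; rewrite g'j wb'; lia.
  + by move: Ebc; rewrite g'j1 wb'; lia.
  by move=> i ij ij1; rewrite g'E.
- apply: all_bad_set => // i ji Qi.
  have iL : (i < L)%N by lia.
  by have := XQ i iL Qi; rewrite -ji; apply: bad_mono.
rewrite /raise_at !lev_set //; try lia.
rewrite eqxx ltn_eqF // gtn_eqF // K set_set_lev.
exact: set_lev_id.
Qed.

(** [raise_at] and [lower_at] are inverse bijections that leave the last level alone, because
    [j.+1 < L]. *)
Lemma sum_move1 (R : nmodType) (F : bpart N D -> R) :
  \sum_(X | is_chain L g X && all_bad Q r X) F (lev X L) =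
  \sum_(X | is_chain L g' X && all_bad Q r X) F (lev X L).
Proof.
rewrite [RHS](reindex_onto raise_at lower_at) => [|X /andP[Xc Xb]]; last first.
  by have [] := lower_atP Xc Xb.
apply: eq_big => X.
  apply/idP/idP => [/andP[Xc Xb]|/andP[/andP[Xc Xb] /eqP <-]].
    by have [-> -> ->] := raise_atP Xc Xb; rewrite eqxx.
  by have [-> -> _] := lower_atP Xc Xb.
by move=> _; rewrite /raise_at lev_set // ?(gtn_eqF jL) // ltnW.
Qed.

End Move.

(* Once the strip [j.+1] has been reduced to size [r j], badness at [j] is automatic. *)
Lemma sum_move (R : nmodType) (F : bpart N D -> R) r j (Q : pred nat) g g' :
  (j.+1 < L)%N -> Q j -> (forall i, Q i -> (i <= j)%N) ->
  r j <= g j.+1 -> r j <= g j -> (forall i, j = i.+1 -> r i + r j < g j) ->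
  g' j = g j + g j.+1 - r j -> g' j.+1 = r j ->
  (forall i, i != j -> i != j.+1 -> g' i = g i) ->
  \sum_(X | is_chain L g X && all_bad Q r X) F (lev X L) =
  \sum_(X | is_chain L g' X && all_bad (fun i => Q i && (i != j)) r X) F (lev X L).
Proof.
move=> jL Qj Q_le rg rg' rr g'j g'j1 g'E.
(* [t] is the number of boxes that strip [j.+1] must lose; they are moved one at a time. *)
have [t tE] : exists t : nat, g j.+1 = r j + t%:Z.
  by exists `|g j.+1 - r j|%N; lia.
elim: t g tE rg rg' rr g'j g'E => [|t IHt] g tE rg rg' rr g'j g'E.
  apply: eq_bigl => X; have -> : is_chain L g X = is_chain L g' X.
    rewrite /is_chain; congr (_ && _); apply: eq_forallb => l.
    suff -> : g l = g' l by [].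
    case: (eqVneq (l : nat) j) => [->|lj]; first by rewrite g'j; lia.
    case: (eqVneq (l : nat) j.+1) => [->|lj1]; first by rewrite g'j1; lia.
    by rewrite g'E.
  case Xc: (is_chain L g' X) => //=; have /is_chainP[_ X1 X2 _] := Xc.
  apply/all_badP/all_badP => XQ i iL; first by case/andP => Qi _; apply: XQ.
  move=> Qi; case: (eqVneq i j) => [->|ij]; last by apply: XQ; rewrite ?Qi.
  apply: bad_weight; first exact: X1.
  by rewrite X2 // g'j1.
pose g1 i : int := g i + (i == j)%:Z - (i == j.+1)%:Z.
have g1j : g1 j = g j + 1 by rewrite /g1 eqxx ltn_eqF //; lia.
have g1j1 : g1 j.+1 = g j.+1 - 1 by rewrite /g1 eqxx gtn_eqF //; lia.
have g1E i : i != j -> i != j.+1 -> g1 i = g i.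
  by rewrite /g1 => /negPf -> /negPf ->; lia.
have rg2 : r j < g j.+1 by lia.
rewrite (@sum_move1 r j Q jL Qj Q_le g g1 g1j g1j1 g1E rg2 rg' rr).
apply: IHt => //; rewrite ?g1j ?g1j1; try lia.
  by move=> i ji; have := rr i ji; lia.
by move=> i ij ij1; rewrite g'E ?g1E.
Qed.

End Chains.

(** * Products of the [h (g l)] as sums over chains *)

Section ChainExpansion.
Variables (R : comNzRingType) (h : int -> R) (D : nat).
Hypothesis h0 : h 0 = 1.
Hypothesis hN : forall z : int, z < 0 -> h z = 0.
Hypothesis hD : forall z : int, D%:Z < z -> h z = 0.
Variables L N : nat.

(** Each strip opens at most one new row. So for [L <= N.+1] every level before the last still has
    its row [ord_max] empty, as [pieri] requires. *)
Lemma chain_rows m g (X : chain L N D) : is_chain m g X ->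
  forall l (k : 'I_N.+1), (l <= L)%N -> (l <= m)%N -> (l <= k)%N -> lev X l k = 0%N :> nat.
Proof.
move=> /is_chainP[X0 X1 X2 X3]; elim=> [|l IHl] k lL lm lk; first by rewrite X0 ffunE.
have /hstripP[_ dec] := X1 l lL lm; apply/eqP; rewrite -leqn0.
have kE : k = (inord k.-1 : 'I_N.+1).+1 :> nat by rewrite inordK prednK ?(leq_trans _ lk) // ltnW.
apply: leq_trans (dec _ _ kE) _; rewrite IHl //; try lia.
Qed.

Lemma chain_hstrip_refl m g (X : chain L N D) : is_chain m g X ->
  forall l, (l <= L)%N -> (l <= m)%N -> hstrip (lev X l) (lev X l).
Proof.
move=> /is_chainP[X0 X1 X2 X3] [|l] lL lm; first by rewrite X0 hstrip_empty.
exact: hstrip_refl (X1 l lL lm).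
Qed.

Lemma sjt_empty : sjt h (empty_part N D) = 1.
Proof.
rewrite /sjt (@jt_trunc _ _ h0 hN 0) ?/jt ?det_mx00 // => i _.
by rewrite ffunE.
Qed.

Lemma sum_is_chain (g : nat -> int) m : (L <= N.+1)%N -> (m <= L)%N ->
  \sum_(X : chain L N D | is_chain m g X) sjt h (lev X m) = \prod_(l < m) h (g l).
Proof.
move=> LN; elim: m => [|m IHm] mL.
  rewrite big_ord0 (big_pred1 [ffun=> empty_part N D]) => [|X].
    by rewrite /lev ffunE sjt_empty.
  apply/is_chainP/eqP => [[X0 _ _ X3]|->]; last first.
    by split=> // *; rewrite /lev ffunE.
  apply/ffunP => i; rewrite ffunE -(inord_val i).
  case: (posnP i) => [->|i0]; first exact: X0.
  by rewrite -(prednK i0); apply: X3 => //; have := ltn_ord i; lia.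
rewrite big_ord_recr /= mulrC -IHm ?(ltnW mL) // mulr_sumr.
transitivity (\sum_(X : chain L N D | is_chain m g X) \sum_(b | hstrip (lev X m) b &&
    (weight b - weight (lev X m) == g m)) sjt h b); last first.
  apply: eq_bigr => X Xc; rewrite pieri //.
    exact: chain_hstrip_refl Xc _ (ltnW mL) (leqnn m).
  by apply: (chain_rows Xc) => //=; [apply: ltnW | lia].
rewrite [RHS]pair_big_dep /=.
(* A chain of [m.+1] strips is a chain of [m] strips together with its level [m.+1]. *)
rewrite [LHS](reindex_onto (fun p : chain L N D * bpart N D => set_lev p.1 m.+1 p.2)
  (fun X => (set_lev X m.+1 (empty_part N D), lev X m.+1))) => [|X _]; last first.
  by rewrite /= set_set_lev set_lev_id.
apply: eq_big => -[X b] /=; last by move=> _; rewrite lev_set // eqxx.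
rewrite set_set_lev lev_set // eqxx -pair_eqE /= eqxx andbT.
have mL' := ltnW mL.
apply/andP/and3P => [[/is_chainP[X0 X1 X2 X3] /eqP XE]|[Xc ab wb]].
  have lvl l : (l <= L)%N -> l != m.+1 -> lev X l = lev (set_lev X m.+1 b) l.
    by move=> lL lm; rewrite lev_set // (negPf lm).
  have lvm : lev X m.+1 = empty_part N D by rewrite -XE lev_set // eqxx.
  have := X1 m mL (ltnSn m); have /eqP := X2 m mL (ltnSn m).
  rewrite !lev_set // eqxx ltn_eqF // => wb ab; split=> //.
  apply/is_chainP; split=> [|l lL lm|l lL lm|l lL lm].
  - by rewrite lvl.
  - by rewrite !lvl ?X1 // ?(ltnW lL) //; lia.
  - by rewrite !lvl ?X2 // ?(ltnW lL) //; lia.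
  by case: (eqVneq l m) => [->//|nlm]; rewrite lvl ?X3 //; lia.
have /is_chainP[X0 X1 X2 X3] := Xc; split; last first.
  by apply/eqP/set_lev_id; apply: X3.
apply/is_chainP; split=> [|l lL lm|l lL lm|l lL lm].
- by rewrite lev_set.
- rewrite !lev_set ?(ltnW lL) // eqSS (ltn_eqF lm).
  by case: (eqVneq l m) => [->//|nlm]; apply: X1 => //; lia.
- rewrite !lev_set ?(ltnW lL) // eqSS (ltn_eqF lm).
  by case: (eqVneq l m) => [->//|nlm]; [apply/eqP | apply: X2 => //; lia].
by rewrite lev_set // eqSS gtn_eqF //; apply: X3 => //; lia.
Qed.

End ChainExpansion.

(** * Hessenberg permutations *)

Section Hessenberg.
Variable N : nat.
Implicit Types (S : {set 'I_N.+1}) (w : {perm 'I_N.+1}).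

Definition sadj (j : nat) : {perm 'I_N.+1} := tperm (inord j) (inord j.+1).

Definition word S (j : nat) : {perm 'I_N.+1} :=
  (\prod_(j <= i < N) (if inord i \in S then sadj i else 1))%g.

Lemma word_ge S j : (N <= j)%N -> word S j = 1%g.
Proof. by move=> Nj; rewrite /word big_geq. Qed.

Lemma wordS S j : (j < N)%N ->
  word S j = ((if inord j \in S then sadj j else 1) * word S j.+1)%g.
Proof. by move=> jN; rewrite /word big_ltn. Qed.

Lemma eq_inord (i j : nat) : (i <= N)%N -> (j <= N)%N ->
  (inord i == inord j :> 'I_N.+1) = (i == j).
Proof. by move=> iN jN; rewrite -val_eqE /= !inordK. Qed.

Lemma sadjL j : sadj j (inord j) = inord j.+1.
Proof. exact: tpermL. Qed.

Lemma sadjR j : sadj j (inord j.+1) = inord j.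
Proof. exact: tpermR. Qed.

Lemma sadjD j (x : 'I_N.+1) : (j < N)%N -> x != j :> nat -> x != j.+1 :> nat ->
  sadj j x = x.
Proof.
move=> jN xj xj1; rewrite tpermD // -val_eqE /= inordK 1?eq_sym //.
exact: ltnW.
Qed.

Lemma down_ind (P : nat -> Prop) :
  (forall j, (N <= j)%N -> P j) -> (forall j, (j < N)%N -> P j.+1 -> P j) ->
  forall j, P j.
Proof.
move=> P0 PS j; have [m] := ubnP (N - j); elim: m j => // m IHm j jm.
by have [/P0//|jN] := leqP N j; apply: PS => //; apply: IHm; lia.
Qed.

Lemma word_fix S j (x : 'I_N.+1) : (x < j)%N -> word S j x = x.
Proof.
elim/down_ind: j => [j Nj|j jN IHj] xj; first by rewrite word_ge ?perm1.
rewrite wordS // permM; case: ifP => _; last by rewrite perm1 IHj // ltnW.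
by rewrite sadjD ?IHj ?ltn_eqF // ltnW.
Qed.

Lemma fix_ge w j (x : 'I_N.+1) : (forall y : 'I_N.+1, (y < j)%N -> w y = y) ->
  (j <= x)%N -> (j <= w x)%N.
Proof.
move=> wj; rewrite leqNgt [(j <= _)%N]leqNgt; apply: contra => xj.
by have E := @perm_inj _ w (w x) x (wj _ xj); rewrite E in xj.
Qed.

Lemma word_hess S j (x : 'I_N.+1) : (x <= (word S j x).+1)%N.
Proof.
elim/down_ind: j x => [j Nj|j jN IHj] x; first by rewrite word_ge ?perm1.
rewrite wordS // permM; case: ifP => _; last by rewrite perm1 IHj.
have [xj|xj] := eqVneq (x : nat) j.
  rewrite -{2}(inord_val x) xj sadjL ltnW // ltnS ltnW //.
  apply: fix_ge => [y|]; first exact: word_fix.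
  by rewrite inordK.
have [xj1|xj1] := eqVneq (x : nat) j.+1; last by rewrite sadjD.
by rewrite -{2}(inord_val x) xj1 sadjR word_fix inordK // ltnW.
Qed.

Lemma word_desc S j i : (j <= i < N)%N ->
  (word S j (inord i.+1) == inord i) = (inord i \in S).
Proof.
elim/down_ind: j => [j Nj|j jN IHj]; first by lia.
case/andP=> ji iN; rewrite wordS // permM.
have [ij|ij] := eqVneq i j.
  rewrite ij; case: ifP => _.
    by rewrite sadjR word_fix ?eqxx // inordK // ltnW.
  rewrite perm1; apply/negP => /eqP E.
  have : (j.+1 <= word S j.+1 (inord j.+1))%N.
    by apply: fix_ge => [y|]; [exact: word_fix | rewrite inordK].
  by rewrite E inordK ?ltnn // ltnW.
have ji' : (j.+1 <= i < N)%N by rewrite iN andbT ltn_neqAle eq_sym ij.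
case: ifP => _; last by rewrite perm1 IHj.
by rewrite sadjD ?IHj // inordK //; lia.
Qed.

Lemma eq_word S S' j : (forall i, (j <= i < N)%N -> (inord i \in S) = (inord i \in S')) ->
  word S j = word S' j.
Proof. by move=> SS'; apply: eq_big_nat => i /SS' ->. Qed.

(** The places where the permutation matrix meets the subdiagonal; they recover [S] from w_S. *)
Definition desc w : {set 'I_N.+1} :=
  [set i : 'I_N.+1 | (i < N)%N && (w (inord i.+1) == i)].

Lemma in_desc w i : (i < N)%N -> (inord i \in desc w) = (w (inord i.+1) == inord i).
Proof. by move=> iN; rewrite inE inordK ?iN // ltnW. Qed.

(** The value [j] is taken at [j] or at [j.+1]. In the second case [sadj j] splits off on the left
    and leaves a permutation fixing [j]; in the first [w] itself fixes [j]. *)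
Lemma word_of_desc w j : (forall x : 'I_N.+1, (x <= (w x).+1)%N) ->
  (forall x : 'I_N.+1, (x < j)%N -> w x = x) -> word (desc w) j = w.
Proof.
elim/down_ind: j w => [j Nj|j jN IHj] w wh wj.
  rewrite word_ge //; apply/permP => x; rewrite perm1.
  have [xj|jx] := ltnP x j; first by rewrite wj.
  apply/val_inj => /=; have := fix_ge wj jx; have := ltn_ord x; have := ltn_ord (w x).
  by lia.
have jN' : (j < N.+1)%N by apply: ltnW.
rewrite wordS // in_desc //; case: eqP => wj1.
  pose w' := (sadj j * w)%g.
  have w'E x : w' x = w (sadj j x) by rewrite permM.
  have w'j : w' (inord j) = inord j by rewrite w'E sadjL.
  have w'D (x : 'I_N.+1) : x != j :> nat -> x != j.+1 :> nat -> w' x = w x.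
    by move=> xj xj1; rewrite w'E sadjD.
  have -> : word (desc w) j.+1 = word (desc w') j.+1.
    apply: eq_word => i /andP[ji iN]; rewrite !in_desc // w'D // inordK //; lia.
  rewrite IHj.
  - by rewrite /w' mulgA tperm2 mul1g.
  - move=> x; have [xj|xj] := eqVneq (x : nat) j.
      by rewrite -[in w' x](inord_val x) xj w'j inordK.
    have [xj1|xj1] := eqVneq (x : nat) j.+1; last by rewrite w'D.
    rewrite xj1 ltnS -(inord_val x) xj1 w'E sadjR.
    by apply: fix_ge => //; rewrite inordK.
  move=> x xj; have [xj'|xj'] := eqVneq (x : nat) j.
    by rewrite -(inord_val x) xj' w'j.
  by rewrite w'D ?wj //; lia.
rewrite mul1g IHj // => x; rewrite ltnS leq_eqVlt => /orP[/eqP xj|/wj//].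
(* The preimage [y] of [j] satisfies [j <= y <= j.+1], and [y = j.+1] is excluded in this case. *)
have [y wy] : exists y, w y = x by exists (w^-1 x)%g; rewrite permKV.
have jy : (j <= y)%N.
  rewrite leqNgt; apply/negP => yj; have := wj _ yj; rewrite wy => xy.
  by rewrite -xy xj ltnn in yj.
have := wh y; rewrite wy xj => yj1.
have [yj|yj] := eqVneq (y : nat) j; first by rewrite -[in LHS](_ : y = x) //; apply/val_inj; rewrite /= yj.
case: wj1; rewrite -[RHS](_ : x = _); last by rewrite -xj inord_val.
by rewrite -wy -[in RHS](inord_val y); congr (w (inord _)); lia.
Qed.

Lemma desc_word S : ord_max \notin S -> desc (word S 0) = S.
Proof.
move=> NS; apply/setP => i; have [iN|Ni] := ltnP i N.
  by rewrite -(inord_val i) in_desc // word_desc.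
have -> : i = ord_max by apply/val_inj => /=; have := ltn_ord i; lia.
by rewrite (negPf NS) inE ltnn.
Qed.

Lemma sum_hessenberg (R : nmodType) (F : {perm 'I_N.+1} -> R) :
  (forall w, ~~ [forall x : 'I_N.+1, (x <= (w x).+1)%N] -> F w = 0) ->
  \sum_w F w = \sum_(S : {set 'I_N.+1} | ord_max \notin S) F (word S 0).
Proof.
move=> F0; rewrite (bigID (fun w => [forall x : 'I_N.+1, (x <= (w x).+1)%N])) /=.
rewrite [X in _ + X]big1 ?addr0 //.
rewrite (reindex_onto (word^~ 0%N) desc) => [|w /forallP wh]; last first.
  by apply: word_of_desc.
apply: eq_bigl => S; apply/andP/idP => [[_ /eqP <-]|NS].
  by rewrite inE ltnn.
by rewrite desc_word // eqxx; split=> //; apply/forallP => x; apply: word_hess.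
Qed.

(** * From the strip sizes of w_S to those of the identity *)

Variables (D : nat) (al be : nat -> int).
Hypothesis al_dec : forall i, al i.+1 < al i.
Hypothesis be_dec : forall i, be i.+1 < be i.
Hypothesis al_be : forall i, al i.+2 < be i.

Let be_le (i j : nat) : (i <= j)%N -> be j <= be i.
Proof.
move=> /subnK <-; elim: (j - i)%N => //= d; apply: le_trans.
by rewrite addSn ltW.
Qed.

(* [inord] is junk beyond [N], where no level of a chain sees [content]. *)
Definition content w (l : nat) : int :=
  if (l <= N)%N then al l - be (w (inord l)) else 0.
(** The degree of the subdiagonal entry in row [j.+1], which is the size of strip [j.+1] as long as
    the factor [sadj j] is present. *)
Definition excess (j : nat) : int := al j.+1 - be j.

Definition upset (X : chain N.+1 N D) : {set 'I_N.+1} :=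
  [set i : 'I_N.+1 | (i < N)%N &&
     bad (lev X i) (lev X i.+1) (lev X i.+2) (excess i)].

(** The factors of w_S are removed from the left, each [sadj j] being traded for badness at [j]. The
    intermediate sums run over the chains with the sizes of [word S j] that are bad at the elements
    of [S] below [j]. *)
Lemma sum_content (R : nmodType) (F : bpart N D -> R) S : ord_max \notin S ->
  \sum_(X : chain N.+1 N D | is_chain N.+1 (content (word S 0)) X) F (lev X N.+1) =
  \sum_(X : chain N.+1 N D | is_chain N.+1 (content 1%g) X && (S \subset upset X))
     F (lev X N.+1).
Proof.
move=> NS; pose Q j i := (i < N)%N && ((inord i \in S) && (i < j)%N).
transitivity (\sum_(X : chain N.+1 N D | is_chain N.+1 (content (word S 0)) X &&
    all_bad (Q 0%N) excess X) F (lev X N.+1)).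
  apply: eq_bigl => X; rewrite (_ : all_bad _ _ _) ?andbT //.
  by apply/all_badP => i _; rewrite /Q ltn0 !andbF.
transitivity (\sum_(X : chain N.+1 N D | is_chain N.+1 (content 1%g) X &&
    all_bad (Q N) excess X) F (lev X N.+1)); last first.
  apply: eq_bigl => X; congr (_ && _); apply/all_badP/subsetP => [XQ i iS|XS i iN].
    have iN : (i < N)%N.
      rewrite ltn_neqAle -ltnS ltn_ord andbT; apply: contra NS => /eqP iN.
      by rewrite (_ : ord_max = i) //; apply/val_inj.
    by rewrite inE iN /=; apply: XQ; rewrite ?ltn_ord // /Q iN inord_val iS.
  by case/and3P => iN' iS _; have := XS _ iS; rewrite inE inordK // iN'.
suff H j : (j <= N)%N -> \sum_(X : chain N.+1 N D | is_chain N.+1 (content (word S j)) X &&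
    all_bad (Q j) excess X) F (lev X N.+1) =
  \sum_(X : chain N.+1 N D | is_chain N.+1 (content 1%g) X &&
    all_bad (Q N) excess X) F (lev X N.+1) by apply: H.
elim/down_ind: j => [j Nj jN|j jN IHj _].
  have -> : j = N by apply/eqP; rewrite eqn_leq jN Nj.
  by rewrite word_ge.
have jN' : (j < N.+1)%N by apply: ltnW.
rewrite -IHj // wordS //; case: ifP => jS; last first.
  rewrite mul1g; apply: eq_bigl => X; congr (_ && _).
  apply: eq_forallb => i; congr (_ ==> _); rewrite /Q [(i < j.+1)%N]leq_eqVlt eqSS.
  by have [->|_] := eqVneq (i : nat) j; rewrite ?jS // ltnn.
set v := word S j.+1.
have vj : v (inord j) = inord j by rewrite word_fix // inordK.
have vj1 : (j < v (inord j.+1))%N.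
  by apply: fix_ge => [y|]; [exact: word_fix | rewrite inordK].
have cE (w : {perm 'I_N.+1}) l : (l <= N)%N -> content w l = al l - be (w (inord l)).
  by rewrite /content => ->.
have cj : content v j = al j - be j by rewrite cE ?vj ?inordK // ltnW.
have cj1 : content v j.+1 = al j.+1 - be (v (inord j.+1)) by rewrite cE.
have bej := be_le vj1; have bejj := be_dec j; have alj := al_dec j.
rewrite (@sum_move N.+1 N D R F excess j (Q j.+1) (content v) (content (sadj j * v)%g)).
- apply: eq_bigl => X; congr (_ && _); apply: eq_forallb => i; congr (_ ==> _).
  by rewrite /Q ltnS [(i < j)%N]ltn_neqAle -!andbA; congr [&& _, _ & _]; rewrite andbC.
- by [].
- by rewrite /Q jN jS ltnSn.
- by move=> i; rewrite /Q ltnS => /and3P[].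
- by rewrite cj1 /excess; lia.
- by rewrite cj /excess; lia.
(* For [j = i.+1] this inequality amounts to [al i.+2 < be i], the absence of a 3x2 block. *)
- by move=> i ji; rewrite cj /excess ji; have := al_be i; lia.
- by rewrite cj cj1 /excess cE 1?ltnW // permM sadjL; lia.
- by rewrite /excess cE // permM sadjR vj inordK.
move=> i ij ij1; rewrite /content permM; case: ifP => // iN.
by rewrite sadjD // inordK.
Qed.

End Hessenberg.

(** * Conjugate partitions *)

Lemma geq_trans : transitive geq.
Proof. by move=> y x z yx zy; apply: leq_trans zy yx. Qed.

Lemma count_gt_sorted (s : seq nat) (i j : nat) : sorted geq s ->
  (i < count (fun x => j < x)%N s)%N = (j < nth 0 s i)%N.
Proof.
elim: s i => [|x s IHs] i /=; first by rewrite nth_nil.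
rewrite (path_sortedE geq_trans) => /andP[xs s_sorted].
case: (ltnP j x) => [jx|xj]; first by case: i => //= i; rewrite add1n ltnS IHs.
rewrite add0n (_ : count _ s = 0)%N.
  rewrite ltn0; symmetry; apply/negbTE; rewrite -leqNgt.
  case: i => //= i; have [si|si] := ltnP i (size s); last by rewrite nth_default.
  by apply: leq_trans xj; have /allP := xs; apply; exact: mem_nth.
apply/eqP; rewrite -leqn0 leqNgt -has_count -all_predC; apply: sub_all xs => y /= yx.
by rewrite -leqNgt (leq_trans yx).
Qed.

Lemma sorted_mkseq (f : nat -> nat) m : (forall i, (f i.+1 <= f i)%N) ->
  sorted geq (mkseq f m).
Proof.
move=> f_dec; apply/(sortedP 0%N) => i; rewrite size_mkseq => im.
by rewrite !nth_mkseq ?(ltnW im) //=; apply: f_dec.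
Qed.

Lemma conjp_partition (s : seq nat) : is_partition (conjp s).
Proof.
apply/andP; split.
  by apply: sorted_mkseq => i; apply: sub_count => x /=; apply: ltnW.
rewrite /conjp; case: s => //= x s; apply/allP => y /mapP[j].
by rewrite mem_iota add0n => /andP[_ jx] ->; rewrite jx.
Qed.

Lemma nth_conjp (s : seq nat) (j : nat) : sorted geq s ->
  nth 0%N (conjp s) j = count (fun x => j < x)%N s.
Proof.
move=> s_sorted; have [js|sj] := ltnP j (head 0%N s); first by rewrite nth_mkseq.
rewrite nth_default ?size_mkseq //; apply/esym/eqP; rewrite -leqn0 leqNgt.
by rewrite count_gt_sorted // nth0 -leqNgt.
Qed.

Lemma conjpK (s : seq nat) : is_partition s -> conjp (conjp s) = s.
Proof.
move=> /andP[s_sorted s_pos]; have /andP[c_sorted _] := conjp_partition s.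
have size_cc : size (conjp (conjp s)) = size s.
  rewrite size_mkseq -nth0 nth_conjp //; apply/eqP.
  by rewrite -all_count.
apply: (@eq_from_nth _ 0%N) => // i; rewrite size_cc => si.
rewrite nth_conjp // /conjp count_map.
rewrite (eq_count (a2 := fun j => j < nth 0 s i)%N) => [|j]; last exact: count_gt_sorted.
have le : (nth 0 s i <= head 0 s)%N.
  rewrite -nth0; case: i si => // i si; have := sorted_leq_nth geq_trans leqnn 0%N s_sorted.
  by apply; rewrite ?inE //; case: (s) si.
rewrite -size_filter -(subnKC le) iotaD filter_cat size_cat.
rewrite (all_filterP _) ?size_iota.
  rewrite (_ : filter _ _ = [::]) ?addn0 //.
  apply/eqP; rewrite -[_ == _]negbK -has_filter; apply/negP => /hasP[j].
  by rewrite mem_iota add0n => /andP[+ _]; rewrite leqNgt => /negP.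
by apply/allP => j; rewrite mem_iota add0n => /andP[].
Qed.

Lemma sumn_conjp (s : seq nat) : is_partition s -> sumn (conjp s) = sumn s.
Proof.
move=> /andP[s_sorted _].
rewrite sumnE big_map /index_iota.
transitivity (\sum_(j <- iota 0 (head 0%N s)) \sum_(x <- s) (j < x)%N)%N.
  by apply: eq_bigr => j _; rewrite -sumn_count sumnE big_map.
rewrite exchange_big sumnE /= big_seq [RHS]big_seq; apply: eq_bigr => x xs.
have le : (x <= head 0 s)%N.
  case: (s) s_sorted xs => //= y s'; rewrite (path_sortedE geq_trans) => /andP[/allP ys _].
  by rewrite inE => /orP[/eqP ->//|/ys].
rewrite -(subnKC le) iotaD big_cat /= [X in (_ + X)%N]big1_seq ?addn0.
  rewrite big_seq (eq_bigr (fun=> 1%N)) => [|j]; last by rewrite mem_iota => /andP[_ ->].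
  by rewrite -big_seq big_const_seq count_predT size_iota iter_addn mul1n addn0.
move=> j; rewrite mem_iota add0n => /andP[_ /andP[xj _]].
by rewrite ltnNge xj.
Qed.

Lemma nth_filter_pos (s : seq nat) (i : nat) : sorted geq s ->
  nth 0%N (filter (fun x => 0 < x)%N s) i = nth 0%N s i.
Proof.
elim: s i => //= x s IHs i; rewrite (path_sortedE geq_trans) => /andP[xs s_sorted].
case: posnP => [x0|_]; last by case: i => //= i; exact: IHs.
have s0 j : nth 0%N s j = 0%N.
  have [js|sj] := ltnP j (size s); last by rewrite nth_default.
  by apply/eqP; rewrite -leqn0 -x0; have /allP := xs; apply; exact: mem_nth.
by rewrite IHs // s0; case: i => //= i; rewrite s0.
Qed.

(** [schur] conjugates its index, so the row lengths are conjugated beforehand; zero rows are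
    dropped to obtain a genuine partition. *)
Definition schur_shape N D (b : bpart N D) : seq nat :=
  conjp (filter (fun x => 0 < x)%N [seq (b i : nat) | i <- enum 'I_N.+1]).

Lemma schur_shapeP k N D (p : 'I_k) (b : bpart N D) : hstrip b b ->
  [/\ is_partition (schur_shape b), (sumn (schur_shape b))%:Z = weight b
    & schur D p (schur_shape b) = sjt (eZ D p) b].
Proof.
move=> /hstripP[_ b_dec]; set s := [seq (b i : nat) | i <- enum 'I_N.+1].
have nth_s i : (i <= N)%N -> nth 0%N s i = b (inord i).
  move=> iN; rewrite (nth_map (inord i)) ?size_enum_ord //; congr (b _ : nat).
  by apply/val_inj; rewrite /= nth_enum_ord // inordK.
have s_sorted : sorted geq s.
  apply/(sortedP 0%N) => i; rewrite size_map size_enum_ord => iN.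
  by rewrite !nth_s //; [apply: b_dec; rewrite !inordK // ltnW | exact: ltnW].
set c := filter (fun x => 0 < x)%N s.
have c_part : is_partition c.
  by rewrite /is_partition (sorted_filter geq_trans) ?filter_all.
split; first exact: conjp_partition.
  rewrite sumn_conjp // -/s /weight -(big_morph Posz PoszD (erefl 0%:Z)).
  rewrite sumnE big_filter big_mkcond big_map big_enum /=.
  by congr Posz; apply: eq_bigr => i _; case: posnP.
rewrite /schur conjpK //.
transitivity (jt (eZ D p) (size c) (nth 0%N c)) => //.
have cN : (size c <= N.+1)%N.
  by rewrite size_filter (leq_trans (count_size _ _)) // size_map size_enum_ord.
rewrite -(jt_trunc _ _ cN) => [|||i ci]; last by rewrite nth_default.
- by apply: eq_jt => i iN; rewrite nth_filter_pos // nth_s.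
- by [].
by case.
Qed.

(** * Temperley-Lieb coefficients *)

Lemma sum_subset_setU1 (I : finType) (V : nmodType) (F : {set I} -> V) a (A : {set I}) :
  a \notin A ->
  \sum_(S : {set I} | S \subset a |: A) F S =
  \sum_(S : {set I} | S \subset A) (F S + F (a |: S)).
Proof.
move=> aA; rewrite (bigID (fun S : {set I} => a \notin S)) big_split /=; congr (_ + _).
  apply: eq_bigl => S; apply/andP/idP => [[SaA aS]|SA].
    by rewrite -(setU1K aA) subsetD1 SaA.
  by rewrite (subset_trans SA) ?subsetUr //; split=> //; apply: contra aA; apply/subsetP.
rewrite (reindex_onto (fun S => a |: S) (fun S => S :\ a)) => [|S /andP[_]]; last first.
  by rewrite negbK; apply: setD1K.
apply: eq_bigl => S; rewrite setU11 andbT.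
apply/andP/idP => [[SaA /eqP SE]|SA].
  by rewrite -SE -(setU1K aA) setSD.
by rewrite setUS // setU1K ?eqxx //; apply: contra aA; apply/subsetP.
Qed.

Section TL.
Variable n : nat.
Implicit Types (a b : tl n).

Lemma tl_mulDl a a' b : tl_mul (a + a') b = tl_mul a b + tl_mul a' b.
Proof.
apply/ffunP => f; rewrite !ffunE -big_split; apply: eq_bigr => g _ /=.
by rewrite -big_split; apply: eq_bigr => h _ /=; rewrite ffunE !mulrDl.
Qed.

Lemma tl_mul_sumr I (r : seq I) (P : pred I) a (b : I -> tl n) :
  tl_mul a (\sum_(i <- r | P i) b i) = \sum_(i <- r | P i) tl_mul a (b i).
Proof.
apply/ffunP => f; rewrite ffunE sum_ffunE.
rewrite (eq_bigr (fun i => \sum_(g : diag n) \sum_(h : diag n)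
  a g * b i h * 2 ^+ nloops g h * (concat g h == f)%:R)); last by move=> i _; rewrite ffunE.
rewrite [RHS]exchange_big; apply: eq_bigr => g _ /=.
rewrite [RHS]exchange_big; apply: eq_bigr => h _ /=.
by rewrite sum_ffunE mulr_sumr !mulr_suml.
Qed.

Lemma tl_mul_ge0 a b : (forall f, 0 <= a f) -> (forall f, 0 <= b f) ->
  forall f, 0 <= tl_mul a b f.
Proof.
move=> a0 b0 f; rewrite ffunE; apply: sumr_ge0 => g _; apply: sumr_ge0 => h _.
by rewrite !mulr_ge0 ?exprn_ge0 ?ler0n.
Qed.

Lemma tl_basis_ge0 (d f : diag n) : 0 <= tl_basis d f.
Proof. by rewrite ffunE ler0n. Qed.

End TL.

(* Summing over subwords turns each factor [t_i - 1] into [1 + (t_i - 1) = t_i]. *)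
Lemma theta_subwords_ge0 N (theta : {perm 'I_N.+1} -> tl N.+1) (T : {set 'I_N.+1}) :
  is_theta theta -> ord_max \notin T ->
  forall tau, 0 <= \sum_(S : {set 'I_N.+1} | S \subset T) theta (word S 0) tau.
Proof.
case=> th1 thM ths NT tau; pose T_ j := [set i in T | (j <= i)%N].
have T0 : T_ 0%N = T by apply/setP => i; rewrite inE andbT.
suff H j f : 0 <= (\sum_(S : {set 'I_N.+1} | S \subset T_ j) theta (word S j)) f.
  by have := H 0%N tau; rewrite T0 sum_ffunE.
elim/(@down_ind N): j f => [j Nj|j jN IHj] f.
  have -> : T_ j = set0.
    apply/setP => i; rewrite !inE; apply/negbTE; apply: contra NT => /andP[iT ji].
    by rewrite (_ : ord_max = i) //; apply/val_inj => /=; have := ltn_ord i; lia.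
  rewrite (big_pred1 set0) => [|S]; last by rewrite subset0.
  by rewrite word_ge // th1 tl_basis_ge0.
have notin_T (S : {set 'I_N.+1}) : S \subset T_ j.+1 -> inord j \notin S.
  by move=> /subsetP ST; apply/negP => /ST; rewrite inE inordK ?ltnn ?andbF // ltnW.
case: (boolP (inord j \in T)) => jT; last first.
  have -> : T_ j = T_ j.+1.
    apply/setP => i; rewrite !inE; case: (boolP (i \in T)) => //= iT.
    rewrite leq_eqVlt; case: eqP => //= ij; case/negP: jT.
    by rewrite ij inord_val.
  rewrite (eq_bigr (fun S => theta (word S j.+1))) // => S ST.
  by rewrite wordS // (negPf (notin_T S ST)) mul1g.
have -> : T_ j = inord j |: T_ j.+1.
  apply/setP => i; rewrite !inE -val_eqE /= inordK; last by rewrite ltnW.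
  rewrite leq_eqVlt eq_sym; case: eqP => //= ij.
  by rewrite andbT (_ : i = inord j) //; apply/val_inj; rewrite /= inordK // ltnW.
rewrite sum_subset_setU1 ?notin_T //.
pose tj : diag N.+1 := t_diag (inord j) (inord j.+1).
have thj : theta (sadj N j) + theta 1%g = tl_basis tj.
  by rewrite ths /= ?th1 ?subrK // !inordK // ltnW.
(* Pairing each [S] with [inord j |: S] factors out the basis diagram [tj] on the left. *)
rewrite (eq_bigr (fun S => tl_mul (tl_basis tj) (theta (word S j.+1)))) => [|S ST].
  by rewrite -tl_mul_sumr; apply: tl_mul_ge0 => // d; apply: tl_basis_ge0.
rewrite -thj tl_mulDl -!thM mul1g addrC; congr (theta _ + theta _).
  rewrite wordS // setU11; congr (_ * _)%g; apply: eq_word => i /andP[ji iN].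
  by rewrite !inE eq_inord ?gtn_eqF // ltnW.
by rewrite wordS // (negPf (notin_T S ST)) mul1g.
Qed.

(** * Schur positivity *)

Lemma partition_dec (s : seq nat) i j : is_partition s -> (i <= j)%N ->
  (nth 0 s j <= nth 0 s i)%N.
Proof.
move=> /andP[s_sorted _] ij; have [js|sj] := ltnP j (size s); last by rewrite nth_default.
apply: (sorted_leq_nth geq_trans leqnn 0%N s_sorted) => //.
by rewrite inE (leq_ltn_trans ij).
Qed.

Lemma no_block_bound (lam mu : seq nat) i : is_partition lam -> is_partition mu ->
  ~ has_block32 lam mu -> (nth 0 lam i.+2 <= (nth 0 mu i).+1)%N.
Proof.
move=> lam_p mu_p nb; rewrite leqNgt; apply/negP => lt; apply: nb.
(* The columns [mu_i + 1] and [mu_i + 2] meet the shape in all three rows. *)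
exists i, (nth 0%N mu i).+1; rewrite /in_skew.
have := partition_dec lam_p (leqnSn i); have := partition_dec lam_p (leqnSn i.+1).
have := partition_dec mu_p (leqnSn i); have := partition_dec mu_p (leqnSn i.+1).
by move=> *; lia.
Qed.

Lemma eZ_gt k D (p : 'I_k) (z : int) : D%:Z < z -> eZ D p z = 0.
Proof.
case: z => [[|d]|d] //= Dd; rewrite /evar insubF //.
by apply/negbTE; rewrite -leqNgt; lia.
Qed.

Lemma eZ_lt0 k D (p : 'I_k) (z : int) : z < 0 -> eZ D p z = 0.
Proof. by case: z. Qed.

Lemma sum_telescope (f : nat -> int) m : \sum_(l < m) (f l.+1 - f l) = f m - f 0%N.
Proof.
elim: m => [|m IHm]; first by rewrite big_ord0 subrr.
by rewrite big_ord_recr /= IHm; lia.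
Qed.

Theorem theorem1p3 (n k D : nat) (lam mu : 'I_k -> seq nat)
  (theta : {perm 'I_n} -> tl n) :
  (1 <= n)%N -> (0 < k)%N ->
  (forall p, is_partition (lam p) /\ is_partition (mu p)) ->
  (forall p, subpart (mu p) (lam p)) ->
  (forall p, ~ has_block32 (lam p) (mu p)) ->
  (forall p, (size (lam p) <= n)%N) ->
  (forall p, (sumn (lam p) + n <= D)%N) ->
  is_theta theta ->
  forall tau : diag n, is_kauffman tau ->
    schur_positive
      (immanant (fun w => theta w tau) (JT_hadamard D n lam mu)).
Proof.
case: n theta => // N theta _ k0 parts _ noblock size_lam deg thetaP tau _.
pose al p (i : nat) : int := (nth 0%N (lam p) i)%:Z - i%:Z.
pose be p (i : nat) : int := (nth 0%N (mu p) i)%:Z - i%:Z.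
have al_dec p i : al p i.+1 < al p i.
  by have := partition_dec (proj1 (parts p)) (leqnSn i); rewrite /al; lia.
have be_dec p i : be p i.+1 < be p i.
  by have := partition_dec (proj2 (parts p)) (leqnSn i); rewrite /be; lia.
have al_be p i : al p i.+2 < be p i.
  have [lam_p mu_p] := parts p.
  by have := no_block_bound i lam_p mu_p (noblock p); rewrite /al /be; lia.
pose M := JT_hadamard D N.+1 lam mu.
have prodM (w : {perm 'I_N.+1}) : \prod_(i < N.+1) M i (w i) =
    \prod_(p < k) \prod_(l < N.+1) eZ D p (content (al p) (be p) w l).
  rewrite exchange_big; apply: eq_bigr => i _; rewrite mxE; apply: eq_bigr => p _.
  by congr (eZ D p _); rewrite /content -ltnS ltn_ord inord_val /al /be; lia.
pose is_ch p (X : chain N.+1 N D) := is_chain N.+1 (content (al p) (be p) (1%g : {perm 'I_N.+1})) X.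
pose up p (X : chain N.+1 N D) := upset (al p) (be p) X.
have wordE (S : {set 'I_N.+1}) : ord_max \notin S ->
  \prod_(i < N.+1) M i (word S 0 i) =
  \sum_(f in family (fun p => [pred X | is_ch p X && (S \subset up p X)]))
     \prod_(p < k) sjt (eZ D p) (lev (f p) N.+1).
  move=> NS; rewrite prodM.
  transitivity (\prod_(p < k) \sum_(X | is_ch p X && (S \subset up p X))
      sjt (eZ D p) (lev X N.+1)); last first.
    exact: (bigA_distr_big_dep (fun p => [pred X | is_ch p X && (S \subset up p X)])).
  apply: eq_bigr => p _.
  rewrite -(@sum_is_chain _ (eZ D p) D (erefl _) (@eZ_lt0 _ _ p) (@eZ_gt _ _ p) N.+1 N) //.
  by rewrite (sum_content (al_dec p) (be_dec p) (al_be p)).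
pose meet (f : {ffun 'I_k -> chain N.+1 N D}) := \bigcap_(p < k) up p (f p).
(* As [k > 0], the intersection lies in some [up p (f p)], which omits [ord_max]. *)
have notin_meet f : ord_max \notin meet f.
  by apply/negP => /bigcapP/(_ (Ordinal k0) isT); rewrite inE ltnn.
pose coef f := \sum_(S : {set 'I_N.+1} | S \subset meet f) theta (word S 0) tau.
have immE : immanant (fun w => theta w tau) M =
  \sum_(f : {ffun 'I_k -> chain N.+1 N D} | [forall p, is_ch p (f p)])
     (\prod_(p < k) sjt (eZ D p) (lev (f p) N.+1)) *~ coef f.
  rewrite /immanant sum_hessenberg => [|w /forallPn[x xw]]; last first.
    (* Below the subdiagonal an entry has a factor of negative degree, so the other permutations
       contribute nothing. *)
    rewrite (bigD1 x) //= mxE (bigD1 (Ordinal k0)) //= eZ_lt0 ?mul0r ?mul0rz //.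
    rewrite -ltnNge in xw; have := al_be (Ordinal k0) (w x).
    have := partition_dec (proj1 (parts (Ordinal k0))) xw.
    by rewrite /al /be; lia.
  transitivity (\sum_(S : {set 'I_N.+1} | ord_max \notin S)
    \sum_(f in family (fun p => [pred X | is_ch p X && (S \subset up p X)]))
     (\prod_(p < k) sjt (eZ D p) (lev (f p) N.+1)) *~ theta (word S 0) tau).
    by apply: eq_bigr => S NS; rewrite wordE // -mulrz_suml.
  (* For a fixed tuple of chains the admissible [S] are exactly the subsets of [meet f]. *)
  rewrite (exchange_big_dep (fun f : {ffun 'I_k -> chain N.+1 N D} =>
      [forall p, is_ch p (f p)])) /= => [|S f _ /familyP fS]; last first.
    by apply/forallP => p; have := fS p => /andP[].
  apply: eq_bigr => f /forallP fch; rewrite /coef mulrz_sumr; apply: eq_bigl => S.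
  apply/andP/bigcapsP => [[_ /familyP fS] p _|Sf]; first by have := fS p => /andP[].
  split; last by apply/familyP => p; rewrite inE fch Sf.
  by apply: contra (notin_meet f) => NS; apply/bigcapP => p _; apply: (subsetP (Sf p isT)).
have topP p X : is_ch p X -> let b := lev X N.+1 in
  [/\ is_partition (schur_shape b), (sumn (schur_shape b) <= D)%N
    & schur D p (schur_shape b) = sjt (eZ D p) b].
  move=> Xch b; have /(schur_shapeP p)[sh_p sh_w sh_E] :=
    chain_hstrip_refl Xch (leqnn _) (leqnn _).
  (* The size of the last level telescopes to the sum of the [al p l - be p l], at most the size of
     [lam p] and so at most [D]. *)
  split=> //; rewrite -lez_nat sh_w; have /is_chainP[X0 _ X2 _] := Xch.
  have -> : weight (lev X N.+1) = \sum_(l < N.+1) (al p l - be p l).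
    have := sum_telescope (fun l => weight (lev X l)) N.+1.
    have w0 : weight (empty_part N D) = 0 by rewrite /weight big1 // => i _; rewrite ffunE.
    rewrite X0 w0 subr0 => <-.
    apply: eq_bigr => l _; rewrite X2 // /content -ltnS ltn_ord inord_val.
    by rewrite perm1.
  apply: (@le_trans _ _ (\sum_(l < N.+1) (nth 0%N (lam p) l)%:Z)).
    by apply: ler_sum => l _; rewrite /al /be; lia.
  rewrite -(big_morph Posz PoszD (erefl 0%:Z)) lez_nat.
  apply: leq_trans (leq_trans (leq_addr N.+1 _) (deg p)).
  rewrite sumnE (big_nth 0%N) -(big_mkord xpredT (nth 0%N (lam p))).
  rewrite (big_cat_nat (n := size (lam p))) //= [X in (_ + X)%N]big1_seq ?addn0 //.
  by move=> i; rewrite mem_index_iota => /andP[_ /andP[si _]]; rewrite nth_default.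
(* The index set consists of all tuples; where some [f p] is not a chain, [[::]] is a placeholder
   and the coefficient [c f] is 0. *)
pose nu (f : {ffun 'I_k -> chain N.+1 N D}) p : seq nat :=
  if is_ch p (f p) then schur_shape (lev (f p) N.+1) else [::].
pose c (f : {ffun 'I_k -> chain N.+1 N D}) : nat :=
  if [forall p, is_ch p (f p)] then `|coef f|%N else 0%N.
exists #|{ffun 'I_k -> chain N.+1 N D}|, (fun t p => nu (enum_val t) p).
exists (fun t => c (enum_val t)); split=> [t p|].
  rewrite /nu; case: ifP => [fp|_]; last by [].
  by have [] := topP _ _ fp.
rewrite immE -(big_enum_val (fun f => (c f)%:R * \prod_(p < k) schur D p (nu f p))) /=.
rewrite big_mkcond; apply: eq_bigr => f _; rewrite /c; case: ifP => [/forallP fch|_].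
  rewrite mulr_natl [RHS]pmulrn.
  have coef0 : 0 <= coef f by apply: theta_subwords_ge0.
  rewrite gez0_abs //; congr (_ *~ _); apply: eq_bigr => p _.
  by rewrite /nu fch; have [_ _ ->] := topP _ _ (fch p).
by rewrite mul0r.
Qed.
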